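(* Consider the Poisson hail model in any dimension $d\ge 1$. For a law $\tilde P$ of $(\tau,R)$ let $$\alpha=\sup\{a\ge -d:\mathbb E[R^{d+a}]<\infty\},\qquad \beta=\sup\{b\ge -1:\mathbb E[\tau^{1+b}]<\infty\}$$ (so that $d+\alpha$ and $1+\beta$ are the critical moments of $R$ and $\tau$). Then: 1. every nontrivial system with $\beta<d$ is unstable; 2. every nontrivial system with $\alpha<0$ or $\beta\le 0$ is unstable; 3. for every point $(\alpha,\beta)$ with $\alpha\beta<d$, $\beta>d$ and $0<\alpha<1$ there is an unstable system (law $\tilde P$ of $(\tau,R)$) with $\mathbb E[R^{d+\alpha}+\tau^{1+\beta}]<\infty$.
   Context: Model. $|x|=\max_i|x_i|$ on $\mathbb Z^d$ and $B(x,R)=\{y\in\mathbb Z^d:|y-x|\le R\}$. A law $\tilde P$ is the probability law of a pair $(\tau,R)$, where $\tau$ (temporal size) takes values in $\mathbb R_+$ and $R\ge 0$ (spatial size) is the radius of the cube $B(\mathbf 0,R)$. Given $\tilde P$ and $\lambda>0$, jobs centered at $x\in\mathbb Z^d$ arrive at the points of a rate $\lambda$ Poisson process on $\mathbb R_+$, independently over $x$, and each job carries an independent mark $(\tau,R)\sim\tilde P$; a job with mark $(\tau,R)$ centered at $x$ requires $\tau$ units of simultaneous service from all servers in $B(x,R)$. For $0\le u\le t$, an admissible path is a piecewise constant right-continuous function $\gamma=\gamma_{u,t}:[u,t]\to\mathbb Z^d$ such that whenever $\gamma(s)\ne\gamma(s-)$ there is a job arriving at time $s$, with some center $x$ and sizes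 $(\tau,R)$, such that $\gamma(s),\gamma(s-)\in B(x,R)$. A job arriving at time $s\in[u,t]$ with center $x$ and spatial size $R$ intersects $\gamma$ if $\gamma(s),\gamma(s-)\in B(x,R)$ (whether or not $\gamma$ jumps at $s$). The load $U(\gamma_{u,t})$ is the sum of the temporal sizes $\tau$ of all jobs intersecting $\gamma_{u,t}$, and the score is $V(\gamma_{u,t})=U(\gamma_{u,t})-(t-u)$. The workload is $$W(t,x)=\sup_{0\le u\le t}\ \sup\{V(\gamma_{u,t}):\gamma_{u,t}\text{ admissible},\ \gamma_{u,t}(t)=x\}\in[0,\infty].$$ A law $\tilde P$ (equivalently, the family of systems as $\lambda$ varies) is stable if there is $\lambda_1>0$ such that for every $0<\lambda<\lambda_1$ the family $\{W(t,\mathbf 0)\}_{t\ge0}$ is tight, i.e. $\lim_{M\to\infty}\sup_{t\ge0}P(W(t,\mathbf 0)>M)=0$. It is unstable if it is not stable. A system is nontrivial if there is interaction between the servers, that is, $\tilde P(\mathbb R_+\times\{0\})<1$ ($R=0$ meaning that the job needs only the single server at its center).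
   Formalization: Laws with τ=0 a.s. are excluded (then W=0 is stable, so item 2 fails for α<0), and ''nontrivial'' means P(R<1)<1 rather than P(R=0)<1 (the same for integer R; for R=1/2 a.s. the servers do not interact and item 1 fails). *)

(* Defs.v *)
From HB Require Import structures.
From mathcomp Require Export all_boot all_order all_algebra.
From mathcomp Require Export all_classical all_reals all_analysis.
Export Order.TTheory GRing.Theory Num.Theory.
Export numFieldNormedType.Exports.

Set Implicit Arguments.
Unset Strict Implicit.
Unset Printing Implicit Defensive.

Local Open Scope classical_set_scope.
Local Open Scope ring_scope.

Definition site (d : nat) := 'rV[int]_d.

Definition supnorm (d : nat) (x : site d) : nat :=
  (\max_(i < d) `|x ord0 i|)%N.

Definition box (R : realType) (d : nat) (x : site d) (r : R) : set (site d) :=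
  [set y | (supnorm (y - x))%:R <= r].

(* A job is named by its center [x] and its rank [n] among the jobs centered
   at [x]. *)
Definition job (d : nat) := (site d * nat)%type.

Record configuration (R : realType) (d : nat) := Configuration {
  arrival : job d -> R ;
  tsize : job d -> R ;    (* tau *)
  radius : job d -> R     (* R *)
}.

Section Paths.
Variables (R : realType) (d : nat) (c : configuration R d).

(* A path on [u, t] is a total function whose values outside [u, t] are never
   inspected. *)
Implicit Types (gamma : R -> site d) (u t s : R).

(* [left_value u gamma s y] means gamma(s-) = y.  At the initial time the
   convention is gamma(u-) = gamma(u). *)
Definition left_value u gamma s (y : site d) : Prop :=
  (s = u /\ y = gamma u) \/ (u < s /\ \forall r \near s^'-, gamma r = y).

Definition piecewise_constant u t gamma : Prop :=
  exists D : seq R, forall r r', u <= r -> r <= r' -> r' <= t ->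
    (forall b, b \in D -> ~~ (r <= b <= r')) -> gamma r = gamma r'.

Definition right_continuous u t gamma : Prop :=
  forall s, u <= s -> s < t -> \forall r \near s^'+, gamma r = gamma s.

Definition admissible u t gamma : Prop :=
  [/\ piecewise_constant u t gamma, right_continuous u t gamma
    & forall s y, u <= s -> s <= t -> left_value u gamma s y -> gamma s <> y ->
      exists2 j : job d, arrival c j = s &
        box j.1 (radius c j) (gamma s) /\ box j.1 (radius c j) y].

Definition intersects u t gamma (j : job d) : Prop :=
  [/\ u <= arrival c j, arrival c j <= t,
      box j.1 (radius c j) (gamma (arrival c j))
    & exists2 y, left_value u gamma (arrival c j) y
               & box j.1 (radius c j) y].

Definition load u t gamma : \bar R :=
  \esum_(j in [set j | intersects u t gamma j]) (tsize c j)%:E.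

Definition score u t gamma : \bar R := (load u t gamma - (t - u)%:E)%E.

Definition workload t (x : site d) : \bar R :=
  ereal_sup [set v | exists u gamma,
    [/\ 0 <= u <= t, admissible u t gamma, gamma t = x & v = score u t gamma]].

End Paths.

Section Model.
Variables (R : realType) (d : nat).

(* A law is a law of the pair (tau, R), in this order.  The last clause only
   excludes tau = 0 a.s.: then every workload vanishes, so the system is
   stable however heavy-tailed R is. *)
Definition hail_law (Pt : probability (R * R)%type R) : Prop :=
  Pt [set z | 0 <= z.1 /\ 0 <= z.2] = 1%E /\ (0 < Pt [set z | (0 < z.1)%R])%E.

(* Job (x, n) arrives at gap (x, 0) + ... + gap (x, n), so that i.i.d.
   exponential gaps of rate [lambda] make the arrival times at x a Poisson
   process of rate [lambda] on the half-line. *)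
Record hail_jobs (Pt : probability (R * R)%type R) (lambda : R)
    (disp : measure_display) (Omega : measurableType disp)
    (P : probability Omega R)
    (gap : job d -> {RV P >-> R}) (mark : job d -> {RV P >-> (R * R)%type}) :
    Prop := HailJobs {
  gap_law : forall j (A : set R), measurable A ->
    distribution P (gap j) A = exponential_prob lambda A ;
  mark_law : forall j (B : set (R * R)), measurable B ->
    distribution P (mark j) B = Pt B ;
  gap_mark_independent : forall (s : seq (job d)) (A : job d -> set R)
      (B : job d -> set (R * R)), uniq s ->
    (forall j, measurable (A j)) -> (forall j, measurable (B j)) ->
    P (\bigcap_(j in [set` s]) (gap j @^-1` A j `&` mark j @^-1` B j)) =
    (\prod_(j <- s) (P (gap j @^-1` A j) * P (mark j @^-1` B j)))%E
}.

Definition hail_configuration (Omega : Type) (gap : job d -> Omega -> R)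
    (mark : job d -> Omega -> R * R) (w : Omega) : configuration R d :=
  {| arrival := fun j => \sum_(k < j.2.+1) gap (j.1, val k) w ;
     tsize := fun j => (mark j w).1 ;
     radius := fun j => (mark j w).2 |}.

(* [P^*] is the outer probability; it agrees with [P] on measurable events, and
   makes the definition meaningful although the workload is a supremum over an
   uncountable family of paths. *)
Definition tight (disp : measure_display) (Omega : measurableType disp)
    (P : probability Omega R) (X : R -> Omega -> \bar R) : Prop :=
  (fun M : R => ereal_sup
     [set (P^*)%mu [set w | (M%:E < X t w)%E] | t in [set t : R | 0 <= t]])
    @ +oo --> 0%E.

(* The joint law of the workloads depends on [Pt] and [lambda] only, hence it
   does not matter on which probability space the jobs are realized. *)
Definition tight_system (Pt : probability (R * R)%type R) (lambda : R) : Prop :=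
  exists (disp : measure_display) (Omega : measurableType disp)
    (P : probability Omega R)
    (gap : job d -> {RV P >-> R}) (mark : job d -> {RV P >-> (R * R)%type}),
    hail_jobs Pt lambda gap mark /\
    tight P (fun t w => workload (hail_configuration gap mark w) t 0).

Definition stable (Pt : probability (R * R)%type R) : Prop :=
  exists2 lambda1 : R, 0 < lambda1 &
    forall lambda : R, 0 < lambda -> lambda < lambda1 -> tight_system Pt lambda.

Definition unstable (Pt : probability (R * R)%type R) : Prop := ~ stable Pt.

(* For real r >= 0, box 0 r is the single site 0 exactly when r < 1.  For
   integer-valued spatial sizes the condition is Pt (R_+ x {0}) < 1. *)
Definition nontrivial (Pt : probability (R * R)%type R) : Prop :=
  (Pt [set z | (z.2 < 1)%R] < 1)%E.

Definition alpha (Pt : probability (R * R)%type R) : \bar R :=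
  ereal_sup [set a%:E | a in [set a : R |
    - d%:R <= a /\ ('E_Pt[(fun z => z.2 `^ (d%:R + a))%R] < +oo)%E]].

Definition beta (Pt : probability (R * R)%type R) : \bar R :=
  ereal_sup [set b%:E | b in [set b : R |
    - 1 <= b /\ ('E_Pt[(fun z => z.1 `^ (1 + b))%R] < +oo)%E]].

End Model.

Arguments stable {R} d Pt.
Arguments unstable {R} d Pt.
Arguments alpha {R} d Pt.

(* Main.v *)
Require Import Defs.
From mathcomp Require Import measurable_realfun ring lra zify.

Set Implicit Arguments.
Unset Strict Implicit.
Unset Printing Implicit Defensive.

Local Open Scope classical_set_scope.
Local Open Scope ring_scope.

(** Why the three families are unstable.

    A workload is large as soon as one path is good, so instability only asks
    for one path that ends at the origin and whose score exceeds any given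
    level with probability at least 1/2; by [unstableP] it suffices to exhibit
    a bad event of probability at most 1/2 off which such a path exists.  Paths
    are built from three moves (waiting, jumping inside the cube of a job,
    collecting the temporal size of a job), recorded by the predicate [reach].

    Heavy temporal sizes, [beta < d].  Jobs of radius at least 1 let a path
    travel at almost linear speed, so within time t the origin is accessible
    from about t^(d+1) space-time points.  A moment of order 1 + b with b < d
    is infinite, so along a sequence of scales t the probability of tau > 2t is
    above t^-(1+b') with b' < d: one of these points carries a job with
    tau > 2t, and a path that collects it and crawls to the origin has score
    above t ([unstable_heavy_service]).  Since d >= 1, this also covers
    [beta <= 0].

    Heavy radii, [alpha < 0].  Now E[R^(d+a)] is infinite for some a < 0, so
    along a sequence of r the cube of side r contains, in every fixed time
    slot, about r^d P(R > r) >> 1 centers of jobs that cover this whole cube.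
    In the unit of time the path alternates K times between collecting a job
    with tau > eta somewhere in the cube and being carried by a covering job to
    the next such place; its score is at least K eta - 1
    ([unstable_heavy_radius]).

    The examples with a b < d.  Take Pareto laws with exponents 1 + b' and
    d + a', slightly larger than 1 + b and d + a, and choose c with
    b'/d < c < 1/a'.  In time t the cube of side r = t^c sees about
    t r^d r^-(d+a') = t^(1-c a') >> 1 jobs covering it entirely, and about
    t r^d t^-(1+b') = t^(c d-b') >> 1 jobs with tau > 2t.  Collecting one of
    the latter and leaping to the origin with one of the former gives a score
    above t ([unstable_leap]).

    All probabilistic estimates are union bounds over jobs (x, n) named by
    center and rank.  The strict inequalities between exponents leave room for
    polynomial losses, so no concentration of the Poisson processes is needed:
    it is enough that, at all relevant sites, no gap exceeds L, and each run of
    L consecutive jobs contains a gap of at least 1 and a job of radius at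
    least 1, where L is a small power of t ([regular_site], [regular_whp]).
    This keeps the n-th arrival time between about n/L and nL. *)

(** * Building paths *)

Section Reach.
Variables (R : realType) (d : nat) (c : configuration R d).
Implicit Types (t v : R) (x y : site d) (j : job d).

(** The jobs that the score relies on are listed in [s] and the others are
    ignored, so that the sign of their temporal sizes does not matter. *)
Definition reach t x v : Prop := exists gamma (s : seq (job d)),
  [/\ admissible c 0 t gamma, gamma t = x, uniq s,
      forall j, j \in s -> intersects c 0 t gamma j
    & v <= \sum_(j <- s) tsize c j].

Lemma reach0 x : reach 0 x 0.
Proof.
exists (fun=> x), [::]; split => //; last by rewrite big_nil.
split; first by exists [::].
- by move=> s s0 s0'; move: (le_lt_trans s0 s0'); rewrite ltxx.
- move=> s y s0 s0' [[-> ->]//|[s00 _]].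
  by move: (lt_le_trans s00 s0'); rewrite ltxx.
Qed.

Lemma reach_le t x v v' : v' <= v -> reach t x v -> reach t x v'.
Proof.
by move=> v'v [g [s [adm gt us sI vs]]]; exists g, s; split=> //; exact: le_trans vs.
Qed.

Lemma workload_ge t x v : 0 <= t -> reach t x v -> ((v - t)%:E <= workload c t x)%E.
Proof.
move=> t0 [gamma [s [adm gt us sI vs]]].
apply: (@le_trans _ _ (score c 0 t gamma)); last first.
  by apply: ereal_sup_ubound; exists 0, gamma; rewrite lexx t0.
rewrite /score subr0 EFinB leeB// /load.
apply: (@le_trans _ _ (\sum_(j <- s) (tsize c j)%:E)%E).
  by rewrite sumEFin lee_fin.
apply: ereal_sup_ubound; exists [set` s].
  by split; [exact: finite_seq|move=> j /= js; apply: sI].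
by rewrite (fsbig_seq _ _ us).
Qed.

(** Values at a single time and just before it are all that [left_value] sees,
    so a path may be prolonged without affecting its past. *)
Lemma left_value_ext u s y (g g' : R -> site d) :
  (forall r, r <= s -> g r = g' r) ->
  left_value u g s y -> u <= s -> left_value u g' s y.
Proof.
move=> gg' [[su yu]|[us ny]] le_us; first by left; rewrite -gg'.
right; split=> //; near=> r.
rewrite -gg'; first by near: r.
by apply: ltW; near: r; exact: nbhs_left_lt.
Unshelve. all: by end_near. Qed.

Lemma left_value_const u s x y (g : R -> site d) a : a < s ->
  (forall r, a <= r -> r < s -> g r = x) ->
  left_value u g s y -> u < s -> y = x.
Proof.
move=> as_ gx [[-> _]|[us ny]] us'; first by rewrite ltxx in us'.
near s^'- => r; rewrite -(gx r).
- by apply/esym; near: r.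
- by near: r; exact: nbhs_left_ge.
- by near: r; exact: nbhs_left_lt.
Unshelve. all: by end_near. Qed.

(** The one construction behind all moves: prolong [gamma] by its last value up
    to time [t'], where it takes the value [y]. *)
Section Step.
Variables (t t' : R) (y : site d) (gamma : R -> site d).
Hypotheses (t0 : 0 <= t) (tt' : t < t') (adm : admissible c 0 t gamma).
Hypothesis joint : gamma t <> y -> exists2 j, arrival c j = t' &
  box j.1 (radius c j) y /\ box j.1 (radius c j) (gamma t).

Let gamma' r := if r < t' then gamma (Num.min r t) else y.

Let g'_le r : r <= t -> gamma' r = gamma r.
Proof. by move=> rt; rewrite /gamma' (le_lt_trans rt tt') min_l. Qed.

Let g'_mid r : t <= r -> r < t' -> gamma' r = gamma t.
Proof. by move=> tr rt; rewrite /gamma' rt min_r. Qed.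

Let g'_end : gamma' t' = y.
Proof. by rewrite /gamma' ltxx. Qed.

Lemma step_left : left_value 0 gamma' t' (gamma t).
Proof.
right; split; first exact: le_lt_trans tt'.
near=> r; apply: g'_mid; near: r; first exact: nbhs_left_ge.
exact: nbhs_left_lt.
Unshelve. all: by end_near. Qed.

Lemma step_admissible : admissible c 0 t' gamma'.
Proof.
have [[D pc] rc aj] := adm; split.
- exists (t :: t' :: D) => r r' r0 rr' r't' nD.
  have [rt|tr] := leP r t.
    have r't : r' < t.
      rewrite ltNge; apply/negP => tr'.
      by have := nD t; rewrite inE eqxx rt tr' => /(_ isT).
    rewrite !g'_le ?(ltW r't)//; apply: pc => //; first exact: ltW.
    by move=> b bD; apply: nD; rewrite !inE bD !orbT.
  have r't2 : r' < t'.
    rewrite ltNge; apply/negP => tr'.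
    by have := nD t'; rewrite !inE eqxx orbT tr' (le_trans rr' r't') => /(_ isT).
  by rewrite !g'_mid ?(ltW tr)// ?(le_trans (ltW tr))// (le_lt_trans rr').
- move=> s s0 st'; have [st|ts] := ltP s t.
    rewrite g'_le ?(ltW st)//; near=> r.
    have rt : r <= t by near: r; exact: nbhs_right_le.
    by rewrite g'_le//; near: r; exact: rc.
  near=> r.
  have sr : s <= r by near: r; exact: nbhs_right_ge.
  have rt' : r < t' by near: r; exact: nbhs_right_lt.
  by rewrite !g'_mid// (le_trans ts).
- move=> s z s0 st' lv; have [st|ts] := leP s t.
    rewrite g'_le// => gz; apply: aj => //.
    by apply: left_value_ext lv s0 => r rs; rewrite g'_le// (le_trans rs).
  have z_eq : z = gamma t.
    apply: (left_value_const ts _ lv (le_lt_trans t0 ts)) => r tr rs.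
    by rewrite g'_mid// (lt_le_trans rs).
  have [s_lt|s_ge] := ltP s t'.
    by rewrite g'_mid ?(ltW ts)// z_eq.
  have -> : s = t' by apply/eqP; rewrite eq_le st'.
  by rewrite g'_end z_eq => /nesym/joint.
Unshelve. all: by end_near. Qed.

Lemma step_intersects j : intersects c 0 t gamma j -> intersects c 0 t' gamma' j.
Proof.
move=> [j0 jt jb [z lz bz]]; split=> //.
- by rewrite (le_trans jt) ?ltW.
- by rewrite g'_le.
- exists z => //; apply: left_value_ext lz j0 => r rj.
  by rewrite g'_le// (le_trans rj).
Qed.

Lemma step_intersects_new j : arrival c j = t' ->
  box j.1 (radius c j) y -> box j.1 (radius c j) (gamma t) ->
  intersects c 0 t' gamma' j.
Proof.
move=> jt by_ bt; split; rewrite jt//.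
- exact/ltW/(le_lt_trans t0).
- by rewrite g'_end.
- by exists (gamma t) => //; exact: step_left.
Qed.

End Step.

Lemma reach_wait t t' x v : 0 <= t -> t <= t' -> reach t x v -> reach t' x v.
Proof.
move=> t0; rewrite le_eqVlt => /predU1P[->//|tt'] [g [s [adm gt us sI vs]]].
have joint : g t <> x -> exists2 j, arrival c j = t' &
  box j.1 (radius c j) x /\ box j.1 (radius c j) (g t) by rewrite gt.
exists (fun r => if r < t' then g (Num.min r t) else x), s; split=> //.
- exact: step_admissible.
- exact: ifF (ltxx _).
- by move=> j js; apply: step_intersects => //; exact: sI.
Qed.

Lemma reach_jump t j x y v : 0 <= t -> t < arrival c j ->
  box j.1 (radius c j) x -> box j.1 (radius c j) y ->
  reach t x v -> reach (arrival c j) y v.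
Proof.
move=> t0 tt' bx by_ [g [s [adm gt us sI vs]]].
set t' := arrival c j in tt' *.
have joint : g t <> y -> exists2 j, arrival c j = t' &
  box j.1 (radius c j) y /\ box j.1 (radius c j) (g t).
  by rewrite gt; exists j.
exists (fun r => if r < t' then g (Num.min r t) else y), s; split=> //.
- exact: step_admissible.
- exact: ifF (ltxx _).
- by move=> k ks; apply: step_intersects => //; exact: sI.
Qed.

Lemma reach_collect t j x v : 0 <= t -> t < arrival c j ->
  box j.1 (radius c j) x ->
  reach t x v -> reach (arrival c j) x (v + tsize c j).
Proof.
move=> t0 tt' bx [g [s [adm gt us sI vs]]].
set t' := arrival c j in tt' *.
have joint : g t <> x -> exists2 j, arrival c j = t' &
  box j.1 (radius c j) x /\ box j.1 (radius c j) (g t) by rewrite gt.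
exists (fun r => if r < t' then g (Num.min r t) else x), (j :: s); split=> //.
- exact: step_admissible.
- exact: ifF (ltxx _).
- rewrite /= us andbT; apply/negP => /sI[_ jt _ _].
  by move: (lt_le_trans tt' jt); rewrite ltxx.
- move=> k; rewrite inE => /predU1P[->|ks]; last first.
    by apply: step_intersects => //; exact: sI.
  by apply: step_intersects_new => //; rewrite gt.
- by rewrite big_cons addrC lerD2l.
Qed.

End Reach.

(** * Sites of the nonnegative orthant *)

Section Sites.
Variable d : nat.

Definition orthant_site (f : 'I_d -> nat) : site d := \row_i (f i)%:Z.

Lemma orthant_box (R : realType) (f g : 'I_d -> nat) (b : nat) (r : R) :
  (forall i, (f i <= g i + b)%N /\ (g i <= f i + b)%N) -> b%:R <= r ->
  box (orthant_site f) r (orthant_site g).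
Proof.
move=> fg br; rewrite /box /=; apply: le_trans br; rewrite ler_nat.
apply/bigmax_leqP => i _; rewrite !mxE; have := fg i; lia.
Qed.

(** One orthant suffices for the counting, and with coordinates in [nat] the
    walk to the origin is a mere iteration of the predecessor. *)
Definition sites m : seq (site d) :=
  [seq orthant_site (fun i => val (f i)) | f : {ffun 'I_d -> 'I_m}].

Lemma size_sites m : size (sites m) = (m ^ d)%N.
Proof. by rewrite size_map -cardT card_ffun !card_ord. Qed.

Lemma uniq_sites m : uniq (sites m).
Proof.
rewrite map_inj_uniq ?enum_uniq// => f g /rowP fg; apply/ffunP => i.
by have := fg i; rewrite !mxE => -[] /val_inj.
Qed.

Lemma sitesP m x : x \in sites m ->
  exists2 f : 'I_d -> nat, x = orthant_site f & forall i, (f i < m)%N.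
Proof. by move=> /mapP[f _ ->]; exists (fun i => val (f i)) => // i; exact: ltn_ord. Qed.

Lemma mem_sites m (f : 'I_d -> nat) : (forall i, (f i < m)%N) ->
  orthant_site f \in sites m.
Proof.
move=> fm; apply/mapP; exists [ffun i => Ordinal (fm i)].
  by rewrite enumT mem_index_enum.
by apply/rowP => i; rewrite !mxE ffunE.
Qed.

Lemma orthant_site0 : orthant_site (fun=> 0%N) = 0.
Proof. by apply/rowP => i; rewrite !mxE. Qed.

Lemma sites_box (R : realType) m x y (r : R) : x \in sites m -> y \in sites m ->
  m%:R <= r -> box x r y.
Proof.
move=> /sitesP[f -> fm] /sitesP[g -> gm]; apply: orthant_box => i.
by have := fm i; have := gm i; lia.
Qed.

Lemma box_center (R : realType) (x : site d) (r : R) : 0 <= r -> box x r x.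
Proof.
move=> r0; rewrite /box /= subrr (_ : supnorm 0 = 0%N)//.
by apply: big1 => i _; rewrite mxE.
Qed.

End Sites.

(** * Paths through regular arrivals *)

Section RegularGaps.
Variables (R : realType) (g r : nat -> R) (L N : nat).

(** [g] lists the gaps and [r] the radii of the jobs at one site.  The runs that
    start before rank [N] may extend beyond it. *)
Definition regular_site : Prop := forall n, (n < N)%N ->
  [/\ 0 < g n, g n <= L%:R, exists2 i, (i < L)%N & 1 <= g (n + i)%N
    & exists2 i, (i < L)%N & 1 <= r (n + i)%N].

Hypothesis reg : regular_site.

Let T n := \sum_(k < n) g k.

Let TS n : T n.+1 = T n + g n. Proof. by rewrite /T big_ord_recr. Qed.

Lemma psum_add_le n k : (n + k <= N)%N -> T (n + k)%N <= T n + k%:R * L%:R.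
Proof.
elim: k => [|k IHk] nkN; first by rewrite addn0 mul0r addr0.
have [_ gL _ _] := reg (n := (n + k)%N) ltac:(lia).
by rewrite addnS TS mulrSr mulrDl mul1r addrA lerD// IHk//; lia.
Qed.

Lemma psum_le n : (n <= N)%N -> T n <= n%:R * L%:R.
Proof. by move=> nN; have := @psum_add_le 0 n nN; rewrite {2}/T big_ord0 add0r. Qed.

Lemma psum_mono n k : (n <= k)%N -> (k <= N)%N -> T n <= T k.
Proof.
move=> /subnK <-; elim: (k - n)%N => // i IHi iN.
have [g0 _ _ _] := reg (n := (i + n)%N) ltac:(lia).
by rewrite addSn TS (le_trans (IHi _)) ?lerDl ?ltW//; lia.
Qed.

Lemma psum_ge0 n : (n <= N)%N -> 0 <= T n.
Proof. by move=> nN; have := psum_mono (leq0n n) nN; rewrite {1}/T big_ord0. Qed.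

Lemma psum_gt0 n : (n < N)%N -> 0 < T n.+1.
Proof.
move=> nN; rewrite TS ltr_wpDl ?psum_ge0//; first exact: ltnW.
by have [] := reg nN.
Qed.

(** Each of the [n] blocks of [L] consecutive gaps contains one of size at least
    1, and the other gaps are positive. *)
Lemma psum_ge n : (0 < L)%N -> (n * L <= N)%N -> n%:R <= T (n * L)%N.
Proof.
move=> L0; elim: n => [|n IHn] nLN; first by rewrite mul0n psum_ge0.
have nLN' : (n * L < N)%N by nia.
have [_ _ [i iL gi] _] := reg nLN'.
rewrite mulrSr; apply: (@le_trans _ _ (T (n * L + i).+1)).
  rewrite TS lerD// (le_trans (IHn _))//; first exact: ltnW.
  by apply: psum_mono; nia.
by apply: psum_mono; nia.
Qed.

(** The first arrival after [s] comes at most [L] later, and a run of [L] jobs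
    starting from it lasts at most [L * L] and contains a wide one. *)
Lemma wide_job_in_window q s : (0 < L)%N -> (q * L + L <= N)%N -> 0 <= s -> s < q%:R ->
  exists n, [/\ s < T n.+1, T n.+1 <= s + (L * L)%:R & 1 <= r n].
Proof.
move=> L0 qN s0 sq.
have q0 : (0 < q)%N by rewrite -(ltr_nat R) (le_lt_trans s0).
have ex : exists n, s < T n.+1.
  exists (q * L).-1; rewrite prednK ?muln_gt0 ?q0//.
  by apply: (lt_le_trans sq); apply: psum_ge => //; lia.
case: (ex_minnP ex) => n sTn nmin.
have nq : (n < q * L)%N.
  have qL0 : (0 < q * L)%N by rewrite muln_gt0 q0.
  rewrite -(prednK qL0) ltnS; apply: nmin; rewrite prednK//.
  by apply: (lt_le_trans sq); apply: psum_ge => //; lia.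
have Tns : T n <= s.
  case: n nmin {sTn nq} => [|n] nmin; first by rewrite /T big_ord0.
  by rewrite leNgt; apply/negP => /nmin; rewrite ltnn.
have [_ _ _ [i iL ri]] := reg (n := n) ltac:(lia).
exists (n + i)%N; split=> //.
  by apply: (lt_le_trans sTn); apply: psum_mono; lia.
rewrite -addnS; apply: (le_trans (psum_add_le _)); first by lia.
by rewrite lerD// natrM ler_wpM2r// ler_nat.
Qed.

End RegularGaps.

Section Deterministic.
Variables (R : realType) (d : nat) (c : configuration R d) (g : job d -> R).
Variables (m L N : nat).
Hypothesis L0 : (0 < L)%N.
Hypothesis arrivalE : forall x n, arrival c (x, n) = \sum_(k < n.+1) g (x, val k).
Hypothesis reg : forall x, x \in sites d m ->
  regular_site (fun n => g (x, n)) (fun n => radius c (x, n)) L N.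

(** At each step the next wide job centered at the current site lowers all the
    positive coordinates by one, which is a move of sup norm 1. *)
Lemma crawl q k (f : 'I_d -> nat) s v : (q * L + L <= N)%N ->
  (forall i, (f i < m)%N) -> (forall i, (f i <= k)%N) ->
  0 <= s -> s + (k * (L * L))%:R < q%:R -> reach c s (orthant_site f) v ->
  exists s', [/\ s <= s', s' <= s + (k * (L * L))%:R & reach c s' 0 v].
Proof.
move=> qN; elim: k f s => [|k IHk] f s fm fk s0 sq rs.
  exists s; split; rewrite ?mul0n ?addr0//; rewrite -orthant_site0.
  suff <- : f = fun=> 0%N by [].
  by apply/funext => i; have := fk i; lia.
have sq' : s < q%:R by apply: le_lt_trans sq; rewrite lerDl ler0n.
have [n [sn nL rn]] := wide_job_in_window (reg (mem_sites fm)) L0 qN s0 sq'.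
have aE : arrival c (orthant_site f, n) = \sum_(i < n.+1) g (orthant_site f, val i).
  exact: arrivalE.
rewrite -aE in sn nL.
pose f' i := (f i).-1.
have rs' : reach c (arrival c (orthant_site f, n)) (orthant_site f') v.
  apply: (reach_jump s0 sn _ _ rs).
    by apply: box_center; apply: le_trans rn.
  by apply: (orthant_box (b := 1%N)) rn => i; rewrite /f'; lia.
have [||||s' [s1 s2 r']] := IHk f' _ _ _ _ _ rs'.
- by move=> i; have := fm i; rewrite /f'; lia.
- by move=> i; have := fk i; rewrite /f'; lia.
- exact: le_trans (ltW sn).
- by apply: le_lt_trans sq; rewrite mulSn natrD addrA lerD2r.
exists s'; split=> //; first exact: le_trans (ltW sn) s1.
by apply: (le_trans s2); rewrite mulSn natrD addrA lerD2r.
Qed.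

Section BigJob.
Variables (j : job d) (N0 : nat).
Hypotheses (jm : j.1 \in sites d m) (jN0 : (j.2 < N0)%N) (N0N : (N0 <= N)%N)
  (rj : 0 <= radius c j).

Lemma big_job_arrival : 0 < arrival c j <= (N0 * L)%:R.
Proof.
case: j jm jN0 => x n /= xm nN0; rewrite arrivalE.
rewrite (psum_gt0 (reg xm)) ?(leq_trans nN0)//=.
apply: (le_trans (psum_le (reg xm) _)); first exact: leq_trans N0N.
by rewrite natrM ler_wpM2r// ler_nat.
Qed.

Lemma reach_big_job : reach c (arrival c j) j.1 (tsize c j).
Proof.
have /andP[a0 _] := big_job_arrival.
have := reach_collect (le_refl _) a0 (box_center _ rj) (reach0 c j.1).
by rewrite add0r.
Qed.

(** Collect the job [j], then walk to the origin. *)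
Lemma workload_crawl q (t : R) : (q * L + L <= N)%N -> t < q%:R ->
  (N0 * L + m * (L * L))%:R <= t -> (((tsize c j) - t)%:E <= workload c t (0 : site d)%R)%E.
Proof.
move=> qN tq tbig; have /andP[a0 aN] := big_job_arrival.
have [f fE fm] := sitesP jm.
have at_ : arrival c j + (m * (L * L))%:R <= t.
  by apply: le_trans tbig; rewrite natrD lerD2r.
have := reach_big_job; rewrite fE => rb.
have [|||s' [s1 s2 rs']] := crawl qN fm (k := m) _ _ _ rb.
- by move=> i; exact/ltnW.
- exact: ltW.
- exact: le_lt_trans tq.
have s'0 : 0 <= s' by rewrite (le_trans (ltW a0)).
apply: workload_ge; first by rewrite (le_trans s'0)// (le_trans s2).
by apply: reach_wait rs' => //; rewrite (le_trans s2).
Qed.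

(** The rank of [i] is so large that [i] arrives after [j]; its cube contains
    both the center of [j] and the origin. *)
Lemma workload_leap (i : job d) N2 q (t : R) : i.1 \in sites d m -> (i.2 < N2)%N ->
  (N2 <= N)%N -> (N0 * L < q)%N -> (q * L <= i.2.+1)%N -> (N2 * L)%:R <= t ->
  m%:R <= radius c i -> (((tsize c j) - t)%:E <= workload c t (0 : site d)%R)%E.
Proof.
case: i => y n /= ym nN2 N2N N0q qn N2t mr.
have /andP[a0 aN] := big_job_arrival.
have ai : arrival c (y, n) <= t.
  rewrite arrivalE; apply: (le_trans (psum_le (reg ym) _)); first by lia.
  by apply: le_trans N2t; rewrite natrM ler_wpM2r// ler_nat.
have ij : arrival c j < arrival c (y, n).
  apply: (le_lt_trans aN); rewrite arrivalE.
  apply: (@lt_le_trans _ _ q%:R); first by rewrite ltr_nat.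
  apply: (le_trans (psum_ge (reg ym) L0 _)); first by lia.
  by apply: (psum_mono (reg ym)) => //; lia.
have bx (z : site d) : z \in sites d m -> box y (radius c (y, n)) z.
  by move=> zm; exact: sites_box mr.
have zm : (0 : site d) \in sites d m.
  have [f _ fm] := sitesP jm.
  by rewrite -orthant_site0; apply: mem_sites => k; have := fm k; lia.
have rs := reach_jump (ltW a0) ij (bx _ jm) (bx _ zm) reach_big_job.
have y0 : 0 <= arrival c (y, n) by apply: ltW; exact: lt_trans ij.
apply: workload_ge; first exact: le_trans ai.
exact: reach_wait rs.
Qed.

End BigJob.
End Deterministic.

(** * Union bounds, independence and tightness *)

Lemma set_cons (T : eqType) (x : T) (s : seq T) :
  [set` x :: s] = x |` [set` s].
Proof.
apply/seteqP; split=> y /=; rewrite inE.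
  by move=> /predU1P[->|ys]; [left|right].
by move=> [->|/= ->]; rewrite ?eqxx ?orbT.
Qed.

Section Prob.
Context {disp : measure_display} {Omega : measurableType disp} {R : realType}
  (P : probability Omega R).
Implicit Types (F G : set Omega).

Lemma union_bound (I : choiceType) (s : seq I) (F : I -> set Omega) (e : R) :
  (forall i, measurable (F i)) -> (forall i, i \in s -> P (F i) <= e%:E)%E ->
  measurable (\bigcup_(i in [set` s]) F i) /\
  (P (\bigcup_(i in [set` s]) F i) <= ((size s)%:R * e)%:E)%E.
Proof.
move=> mF; rewrite bigcup_seq; elim: s => [|i s IHs] Fe.
  by rewrite big_nil mul0r measure0.
have [|mU IH] := IHs; first by move=> j js; apply: Fe; rewrite inE js orbT.
rewrite big_cons; split; first exact: measurableU.
apply: le_trans (measureU2 _ (mF i) mU) _.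
by rewrite /= mulrS mulrDl mul1r EFinD leeD// Fe// mem_head.
Qed.

Lemma not_none (I : choiceType) (E : I -> set Omega) (s : seq I) w :
  ~ (\bigcap_(i in [set` s]) ~` E i) w -> exists2 i, i \in s & E i w.
Proof.
by apply: contra_notP => nE i /= si Ei; apply: nE; exists i.
Qed.

Lemma prob_setU_le F G (a b : R) : measurable F -> measurable G ->
  (P F <= a%:E)%E -> (P G <= b%:E)%E -> (P (F `|` G) <= (a + b)%:E)%E.
Proof.
by move=> mF mG Fa Gb; rewrite EFinD (le_trans (measureU2 _ mF mG))// leeD.
Qed.

(** Independence passes to complements.  The induction moves the indices one by
    one from the complemented to the uncomplemented family, whence the two lists
    in the auxiliary claim. *)
Lemma prob_none (I : choiceType) (E : I -> set Omega) (p : R) :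
  (forall i, measurable (E i)) ->
  (forall s, uniq s -> P (\bigcap_(i in [set` s]) E i) = (p ^+ size s)%:E) ->
  forall s, uniq s ->
  P (\bigcap_(i in [set` s]) ~` E i) = ((1 - p) ^+ size s)%:E.
Proof.
move=> mE indep.
suff main s s' : uniq (s ++ s') ->
    P (\bigcap_(i in [set` s]) ~` E i `&` \bigcap_(i in [set` s']) E i) =
    ((1 - p) ^+ size s * p ^+ size s')%:E.
  move=> s us; have := main s [::]; rewrite cats0 => /(_ us).
  by rewrite set_nil bigcap_set0 setIT mulr1.
have mI (u : seq I) (G : I -> set Omega) : (forall i, measurable (G i)) ->
    measurable (\bigcap_(i in [set` u]) G i).
  by move=> mG; apply: fin_bigcap_measurable => //; exact: finite_seq.
elim: s s' => [|i s IHs] s' us.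
  by rewrite set_nil bigcap_set0 setTI mul1r indep.
rewrite set_cons bigcap_setU1.
set X := \bigcap_(i in [set` s]) ~` E i; set Y := \bigcap_(i in [set` s']) E i.
have -> : ~` E i `&` X `&` Y = (X `&` Y) `\` E i.
  by rewrite setDE -setIA setIC.
have mX : measurable X by apply: mI => k; exact: measurableC.
have mY : measurable Y by exact: mI.
have -> : P ((X `&` Y) `\` E i) = (P (X `&` Y) - P (X `&` Y `&` E i))%E.
  apply: measureD => //; first exact: measurableI.
  by rewrite (le_lt_trans (probability_le1 _ _)) ?ltry//; exact: measurableI.
have -> : X `&` Y `&` E i = X `&` \bigcap_(k in [set` (i :: s')]) E k.
  by rewrite set_cons bigcap_setU1 -setIA (setIC Y).
rewrite /X /Y !IHs//; last 2 first.
- by have := uniq_catCA s [:: i] s'; rewrite /= => ->.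
- by move: us => /andP[].
by rewrite /= !exprS -EFinB; congr EFin; ring.
Qed.

Lemma not_tight (X : R -> Omega -> \bar R) :
  (forall M : R, exists t F, [/\ 0 <= t, measurable F, (P F <= (2^-1)%:E)%E
    & forall w, ~ F w -> (M%:E < X t w)%E]) -> ~ tight P X.
Proof.
move=> nt tX.
have /tX : nbhs (0%E : \bar R) [set x | (x < (2^-1 : R)%:E)%E].
  apply: open_nbhs_nbhs; split; first exact: open_ereal_lt_ereal.
  by rewrite /= lte_fin invr_gt0 ltr0n.
move=> [M [_ /(_ (M + 1))]]; rewrite ltrDl ltr01 /= => /(_ isT).
have [t [F [t0 mF Fle XF]]] := nt (M + 1).
apply/negP; rewrite -leNgt.
apply: (@le_trans _ _ ((P^*)%mu [set w | ((M + 1)%:E < X t w)%E])); last first.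
  by apply: ereal_sup_ubound; exists t.
apply: (@le_trans _ _ ((P^*)%mu (~` F))); last exact: le_outer_measure.
have -> : ((P^*)%mu (~` F) = 1 - P F)%E.
  rewrite -probability_setC//; apply: measurable_mu_extE; exact: measurableC.
rewrite leeBrDr; last by rewrite ge0_fin_numE// (le_lt_trans Fle)// ltry.
apply: (@le_trans _ _ ((2^-1)%:E + (2^-1)%:E)%E); first by rewrite leeD2l.
by rewrite -EFinD lee_fin; lra.
Qed.

End Prob.

(** * Exponential gaps and independent marks *)

Section Law.
Variable R : realType.

Lemma measurable_tau (D : set R) : measurable D ->
  measurable [set z : R * R | D z.1].
Proof.
move=> mD; rewrite [X in measurable X](_ : _ = setT `&` fst @^-1` D) ?setTI//.
by rewrite -[X in measurable X]setTI; exact: measurable_fst.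
Qed.

Lemma measurable_radius (D : set R) : measurable D ->
  measurable [set z : R * R | D z.2].
Proof.
move=> mD; rewrite [X in measurable X](_ : _ = setT `&` snd @^-1` D) ?setTI//.
by rewrite -[X in measurable X]setTI; exact: measurable_snd.
Qed.

Lemma exponential_prob_itv0oc (rate h : R) : 0 <= h ->
  exponential_prob rate `]0, h] = (1 - expR (- rate * h))%:E.
Proof.
rewrite le_eqVlt => /predU1P[<-|h0].
  by rewrite mulr0 expR0 subrr set_itvoc0 /exponential_prob integral_set0.
have := exponential_prob_itv0c rate h0; rewrite -EFinB => <-.
rewrite /exponential_prob integral_itv_obnd_cbnd//.
apply/measurable_EFinP; apply: measurable_funTS.
exact: measurable_exponential_pdf.
Qed.

Lemma measurable_tau_gt (a : R) : measurable [set z : R * R | a < z.1].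
Proof.
have := @measurable_tau [set` `]a, +oo[] (measurable_itv _).
by under eq_set do rewrite /= in_itv/= andbT.
Qed.

Lemma measurable_radius_gt (a : R) : measurable [set z : R * R | a < z.2].
Proof.
have := @measurable_radius [set` `]a, +oo[] (measurable_itv _).
by under eq_set do rewrite /= in_itv/= andbT.
Qed.

Section Rate.
Variables (rate : R) (rate0 : 0 < rate).

(** [exponential_prob rate] is a probability only for a positive rate; naming
    it makes the measure theory of probabilities applicable. *)
Lemma exponential_law : exists E : probability (measurableTypeR R) R,
  forall A, E A = exponential_prob rate A.
Proof. by unshelve eexists (exponential_prob rate : probability _ R). Qed.

Lemma exponential_probT : exponential_prob rate [set: R] = 1%E.
Proof. by have [E EE] := exponential_law; rewrite -EE probability_setT. Qed.

Lemma exponential_prob_oc a b : 0 <= a -> a <= b ->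
  exponential_prob rate `]a, b] = (expR (- rate * a) - expR (- rate * b))%:E.
Proof.
move=> a0 ab; have b0 := le_trans a0 ab; have [E EE] := exponential_law.
have -> : [set` `]a, b]] = [set` `]0, b]] `\` [set` `]0, a]].
  apply/seteqP; split=> x /=; rewrite !in_itv/=.
    by move=> /andP[ax ->]; rewrite (le_lt_trans a0 ax)/= leNgt ax.
  by move=> [/andP[x0 ->]]; rewrite x0 /= andbT => /negP; rewrite -ltNge.
pose G (h : R) : set R := [set` `]0, h]]; rewrite -EE -/(G b) -/(G a).
have -> : (E (G b `\` G a) = E (G b) - E (G a))%E.
  rewrite -[in X in (_ - X)%E](_ : G b `&` G a = G a).
    apply: measureD => //; first exact: measurable_itv.
      exact: measurable_itv.
    by rewrite (le_lt_trans (probability_le1 _ _)) ?ltry//; exact: measurable_itv.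
  apply/setIidPr => x; rewrite /G /= !in_itv/= => /andP[-> xa].
  exact: le_trans ab.
rewrite !EE !exponential_prob_itv0oc// -EFinB; congr EFin; lra.
Qed.

Lemma exponential_prob_oc_compl a b : 0 <= a -> a <= b ->
  exponential_prob rate (~` `]a, b]) =
  (1 - (expR (- rate * a) - expR (- rate * b)))%:E.
Proof.
move=> a0 ab; have [E EE] := exponential_law.
have := probability_setC E (measurable_itv `]a, b]).
by rewrite !EE exponential_prob_oc// -EFinB.
Qed.

End Rate.

End Law.

Section Hail.
Context {R : realType} {d : nat} (Pt : probability (R * R)%type R) (lambda : R)
  {disp : measure_display} {Omega : measurableType disp}
  (P : probability Omega R)
  (gap : job d -> {RV P >-> R}) (mark : job d -> {RV P >-> (R * R)%type}).
Hypotheses (lambda0 : 0 < lambda) (hj : hail_jobs Pt lambda gap mark).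

Let gapP j (A : set R) : measurable A ->
  P (gap j @^-1` A) = exponential_prob lambda A.
Proof. by move=> mA; rewrite -(gap_law hj j). Qed.

Let markP j (B : set (R * R)) : measurable B -> P (mark j @^-1` B) = Pt B.
Proof. by move=> mB; rewrite -(mark_law hj j). Qed.

Definition job_event (A : set R) (B : set (R * R)) j : set Omega :=
  gap j @^-1` A `&` mark j @^-1` B.

Lemma measurable_job_event A B j : measurable A -> measurable B ->
  measurable (job_event A B j).
Proof.
move=> mA mB; apply: measurableI.
  by rewrite -[X in measurable X]setTI; exact: measurable_funPT.
by rewrite -[X in measurable X]setTI; exact: measurable_funPT.
Qed.

Section Family.
Variables (A : set R) (B : set (R * R)) (a b : R).
Hypotheses (mA : measurable A) (mB : measurable B).
Hypotheses (Aa : exponential_prob lambda A = a%:E) (Bb : Pt B = b%:E).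

Lemma prob_all_jobs (s : seq (job d)) : uniq s ->
  P (\bigcap_(j in [set` s]) job_event A B j) = ((a * b) ^+ size s)%:E.
Proof.
move=> us; rewrite (gap_mark_independent hj (A := fun=> A) (B := fun=> B))//.
elim: s {us} => [|j s IHs]; first by rewrite big_nil.
by rewrite big_cons IHs gapP// markP// Aa Bb exprS !EFinM.
Qed.

Lemma prob_job j : P (job_event A B j) = (a * b)%:E.
Proof.
have := @prob_all_jobs [:: j] isT.
by rewrite set_cons1 bigcap_set1.
Qed.

Lemma prob_no_job (s : seq (job d)) : uniq s ->
  measurable (\bigcap_(j in [set` s]) ~` job_event A B j) /\
  (P (\bigcap_(j in [set` s]) ~` job_event A B j) <=
    (expR (- (a * b * (size s)%:R)))%:E)%E.
Proof.
move=> us; split.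
  apply: fin_bigcap_measurable; first exact: finite_seq.
  by move=> j _; apply: measurableC; exact: measurable_job_event.
rewrite (prob_none _ prob_all_jobs)//; last first.
  by move=> j; exact: measurable_job_event.
have ab1 : a * b <= 1.
  by rewrite -lee_fin -(prob_job ((0 : site d), 0%N)) probability_le1//; exact: measurable_job_event.
have -> : - (a * b * (size s)%:R) = (size s)%:R * - (a * b) by ring.
rewrite lee_fin expRM_natl lerXn2r ?nnegrE ?expR_ge0 ?subr_ge0//.
exact: expR_ge1Dx.
Qed.

End Family.

(** With enough candidates, one of them has its gap in [A] and its mark in [B]:
    the jobs to collect and the jobs to leap with are found in this way. *)
Lemma no_job_le (A : set R) (B : set (R * R)) (a b y : R) (s : seq (job d)) :
  measurable A -> measurable B -> 0 <= a -> 0 <= b ->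
  (a%:E <= exponential_prob lambda A)%E -> (b%:E <= Pt B)%E ->
  uniq s -> y <= a * b * (size s)%:R ->
  measurable (\bigcap_(j in [set` s]) ~` job_event A B j) /\
  (P (\bigcap_(j in [set` s]) ~` job_event A B j) <= (expR (- y))%:E)%E.
Proof.
move=> mA mB a0 b0 aA bB us yab; have [E EE] := exponential_law lambda0.
have AE : exponential_prob lambda A = (fine (E A))%:E.
  by rewrite -EE fineK// ge0_fin_numE// (le_lt_trans (probability_le1 _ _)) ?ltry.
have BE : Pt B = (fine (Pt B))%:E.
  by rewrite fineK// ge0_fin_numE// (le_lt_trans (probability_le1 _ _)) ?ltry.
have [mN PN] := prob_no_job mA mB AE BE us; split=> //; apply: (le_trans PN).
rewrite lee_fin ler_expR lerN2 (le_trans yab)// ler_wpM2r// ler_pM//.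
  by rewrite -lee_fin -AE.
by rewrite -lee_fin -BE.
Qed.

Definition job_run (L : nat) (j : job d) : seq (job d) :=
  [seq (j.1, (j.2 + i)%N) | i <- iota 0 L].

Lemma uniq_job_run L j : uniq (job_run L j).
Proof. by rewrite map_inj_uniq ?iota_uniq// => i k [] /addnI. Qed.

Lemma size_job_run L j : size (job_run L j) = L.
Proof. by rewrite size_map size_iota. Qed.

Definition job_box (m n0 n : nat) : seq (job d) :=
  [seq (x, i) | x <- sites d m, i <- iota n0 n].

Lemma uniq_job_box m n0 n : uniq (job_box m n0 n).
Proof.
apply: allpairs_uniq; [exact: uniq_sites|exact: iota_uniq|].
by move=> [x i] [y k] _ _ /= [-> ->].
Qed.

Lemma size_job_box m n0 n : size (job_box m n0 n) = (m ^ d * n)%N.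
Proof. by rewrite size_allpairs size_sites size_iota. Qed.

Lemma mem_job_box m n0 n j : (j \in job_box m n0 n) =
  (j.1 \in sites d m) && (n0 <= j.2 < n0 + n)%N.
Proof.
apply/allpairsP/idP => [[[x i] /= [xm]]|].
  by rewrite mem_iota => im -> /=; rewrite xm.
by case: j => x i /andP[xm im]; exists (x, i); rewrite mem_iota.
Qed.

Lemma job_eventT A j : job_event A setT j = gap j @^-1` A.
Proof. by rewrite /job_event preimage_setT setIT. Qed.

Lemma job_eventTl B j : job_event setT B j = mark j @^-1` B.
Proof. by rewrite /job_event preimage_setT setTI. Qed.

(** At a given site and rank, each of the four requirements of [regular_site]
    fails with a probability that is exponentially small in [L]; [rho] is the
    worst of the rates. *)
Lemma regular_whp : nontrivial Pt -> exists rho : R, [/\ 0 < rho, rho < 1 &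
  forall m L N : nat, exists F : set Omega,
   [/\ measurable F, (P F <= ((m ^ d * N)%:R * (3 * rho ^+ L))%:E)%E
    & forall w, ~ F w -> forall x, x \in sites d m ->
      regular_site (fun n => gap (x, n) w)
        (fun n => radius (hail_configuration gap mark w) (x, n)) L N]].
Proof.
move=> nontriv.
pose W : set (R * R) := [set z | z.2 < 1].
have mW : measurable W.
  have := @measurable_radius R `]-oo, 1[ (measurable_itv _).
  by under eq_set do rewrite /= in_itv/=.
have [p Wp] : exists p, Pt W = p%:E.
  exists (fine (Pt W)); rewrite fineK//.
  by rewrite ge0_fin_numE// (le_lt_trans (probability_le1 _ _)) ?ltry.
have p1 : p < 1 by rewrite -lte_fin -Wp.
have p0 : 0 <= p by rewrite -lee_fin -Wp.
pose e1 := expR (- lambda).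
have e10 : 0 < e1 by exact: expR_gt0.
have e11 : e1 < 1 by rewrite /e1 -expR0 ltr_expR oppr_lt0.
pose e2 := 1 - (expR (- lambda * 1) - expR (- lambda * 2)).
have e21 : e2 < 1.
  by rewrite /e2 ltrBlDr ltrDl subr_gt0 ltr_expR !mulNr ltrN2 ltr_pM2l// ltr1n.
have e20 : 0 <= e2.
  rewrite /e2 subr_ge0 mulr1 (le_trans _ (ltW e11))// lerBlDr lerDl.
  exact: expR_ge0.
pose rho := Num.max e1 (Num.max e2 p).
have r1 : e1 <= rho by rewrite le_max lexx.
have r2 : e2 <= rho by rewrite !le_max lexx orbT.
have r3 : p <= rho by rewrite !le_max lexx !orbT.
have rho0 : 0 < rho by exact: lt_le_trans r1.
exists rho; split=> //.
  by rewrite !gt_max e11 p1 e21.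
move=> m L N.
pose F1 j := job_event (~` `]0, L%:R]) setT j.
(* A gap in ]1, 2] is asked for, rather than one of at least 1, because the
   complement of this event has an explicit probability. *)
pose F2 j := \bigcap_(i in [set` job_run L j]) job_event (~` `]1, 2]) setT i.
pose F3 j := \bigcap_(i in [set` job_run L j]) job_event setT W i.
pose F j := F1 j `|` (F2 j `|` F3 j).
have mC (h k : R) : measurable (~` `]h, k]) by exact: measurableC.
have mF1 j : measurable (F1 j).
  exact: measurable_job_event.
have mF23 A B j : measurable A -> measurable B ->
    measurable (\bigcap_(i in [set` job_run L j]) job_event A B i).
  move=> mA mB; apply: fin_bigcap_measurable; first exact: finite_seq.
  by move=> i _; exact: measurable_job_event.
have mF2 j : measurable (F2 j) by exact: mF23.
have mF3 j : measurable (F3 j) by exact: mF23.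
have PtT : Pt setT = 1%:E by rewrite probability_setT.
have exT : exponential_prob lambda [set: R] = 1%:E by exact: exponential_probT lambda0.
have P1 j : (P (F1 j) <= (rho ^+ L)%:E)%E.
  have := prob_job (mC _ _) _ (exponential_prob_oc_compl lambda0 (lexx _) (ler0n R L)) PtT.
  rewrite /F1 => -> //; rewrite lee_fin mulr1 mulr0 expR0 opprB addrC subrK.
  by rewrite mulrC expRM_natl lerXn2r// nnegrE ltW.
have P2 j : (P (F2 j) <= (rho ^+ L)%:E)%E.
  have := prob_all_jobs (mC _ _) _ (exponential_prob_oc_compl lambda0 ler01 (ler1n R 2)) PtT.
  rewrite /F2 => -> //; last exact: uniq_job_run.
  by rewrite lee_fin size_job_run mulr1 lerXn2r// nnegrE; exact: ltW.
have P3 j : (P (F3 j) <= (rho ^+ L)%:E)%E.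
  rewrite /F3 (prob_all_jobs _ _ exT Wp)//.
    by rewrite lee_fin size_job_run mul1r lerXn2r// nnegrE; exact: ltW.
  exact: uniq_job_run.
have mF j : measurable (F j).
  by apply: measurableU => //; exact: measurableU.
have PF j : (P (F j) <= (3 * rho ^+ L)%:E)%E.
  rewrite (_ : 3 * rho ^+ L = rho ^+ L + (rho ^+ L + rho ^+ L)); last by ring.
  apply: prob_setU_le => //; first exact: measurableU.
  exact: prob_setU_le.
have [mU PU] := @union_bound _ _ _ P _ (job_box m 0 N) F _ mF (fun j _ => PF j).
exists (\bigcup_(j in [set` job_box m 0 N]) F j); split=> //.
  by apply: le_trans PU _; rewrite size_job_box.
move=> w nFw x xm n nN.
have : ~ F (x, n) w.
  move=> Fw; apply: nFw; exists (x, n) => //=.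
  by rewrite mem_job_box xm.
move=> /not_orP[nF1 /not_orP[nF2 nF3]].
move: nF1; rewrite /F1 job_eventT /= in_itv /= => /contrapT/andP[g0 gL].
split=> //.
  move: nF2; apply: contra_notP => nex i /= /mapP[k].
  rewrite mem_iota add0n /= => kL ->; rewrite job_eventT /= in_itv /= => /andP[/ltW g1 _].
  by apply: nex; exists k.
move: nF3; apply: contra_notP => nex i /= /mapP[k].
rewrite mem_iota add0n /= => kL ->; rewrite job_eventTl /= /W /=.
by rewrite ltNge; apply/negP => wide; apply: nex; exists k.
Qed.

End Hail.

(** * Growth estimates and heavy tails *)

Section Analysis.
Variable R : realType.

Lemma pow2_powR (n : nat) : (2 ^ n)%:R = (2 : R) `^ n%:R.
Proof. by rewrite powR_mulrn// natrX. Qed.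

Lemma expRN_small (x y : R) : 3 <= x -> 2 `^ x <= y -> expR (- y) <= 8^-1.
Proof.
move=> x3 xy; have y8 : 8 <= y.
  apply: le_trans xy; rewrite (_ : 8 = 2 `^ 3%:R); last by rewrite -pow2_powR.
  by apply: ler_powR => //; rewrite ler1n.
rewrite expRN lef_pV2 ?posrE ?expR_gt0//.
by apply: le_trans (expR_ge1Dx y); lra.
Qed.

(** With [c = - ln rho], one term of the exponential series gives
    [expR (c n) >= (c n)^(J+1) / (J+1)!], which leaves a factor [1/n]. *)
Lemma geometric_beats_power (rho C e : R) (J : nat) : 0 < rho -> rho < 1 -> 0 <= C -> 0 < e ->
  exists n0, forall n, (n0 <= n)%N -> C * n%:R ^+ J * rho ^+ n <= e.
Proof.
move=> r0 r1 C0 e0; pose c := - ln rho.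
have c0 : 0 < c by rewrite /c oppr_gt0 ln_lt0// r0.
pose K := C * J.+1`!%:R / c ^+ J.+1.
have K0 : 0 <= K by rewrite /K divr_ge0 ?mulr_ge0// exprn_ge0// ltW.
exists (Num.truncn (K / e)).+1 => n nK.
have n0 : 0 < n%:R :> R by rewrite ltr0n; lia.
have Kn : K / e < n%:R.
  by apply: lt_le_trans (truncnS_gt _) _; rewrite ler_nat.
have -> : rho ^+ n = (expR (c * n%:R))^-1.
  by rewrite -expRN mulrC -mulrN opprK expRM_natl lnK.
have big : (c * n%:R) ^+ J.+1 / J.+1`!%:R <= expR (c * n%:R).
  apply: le_trans (expR_ge1Dxn J _); last by rewrite mulr_ge0 ?ltW.
  by rewrite lerDr.
have pos : 0 < (c * n%:R) ^+ J.+1 / J.+1`!%:R.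
  by rewrite divr_gt0 ?exprn_gt0 ?mulr_gt0// ltr0n fact_gt0.
apply: (@le_trans _ _ (C * n%:R ^+ J * ((c * n%:R) ^+ J.+1 / J.+1`!%:R)^-1)).
  rewrite ler_wpM2l ?mulr_ge0 ?exprn_ge0// ?(ltW n0)//.
  by rewrite lef_pV2 ?posrE ?expR_gt0.
have -> : C * n%:R ^+ J * ((c * n%:R) ^+ J.+1 / J.+1`!%:R)^-1 = K / n%:R.
  have alg (a b n' F : R) : a != 0 -> b != 0 -> n' != 0 -> F != 0 ->
      C * b * (a * (n' * b) / F)^-1 = C * F / a / n'.
    by move=> *; field; apply/and4P.
  rewrite /K exprMn (exprS n%:R) alg// ?expf_neq0 ?gt_eqF//.
by rewrite ler_pdivrMr// mulrC -ler_pdivrMr// ltW.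
Qed.

Lemma pow2_unbounded (C delta : R) : 0 < delta ->
  exists k0 : nat, forall k, (k0 <= k)%N -> C <= 2 `^ (k%:R * delta).
Proof.
move=> d0; have l2 : 0 < ln 2 :> R by rewrite ln_gt0// ltr1n.
have dl : 0 < delta * ln 2 by exact: mulr_gt0.
exists (Num.truncn (C / (delta * ln 2))).+1 => k kk.
rewrite /powR pnatr_eq0/=; apply: le_trans (expR_ge1Dx _).
apply: (@le_trans _ _ (k%:R * (delta * ln 2))); last by rewrite mulrA lerDr.
rewrite -ler_pdivrMr//; apply: ltW; apply: lt_le_trans (truncnS_gt _) _.
by rewrite ler_nat.
Qed.

(** With [l] at least a fixed fraction of [k], the exponential gain at
    [L = 2 ^ l] beats any number of sites and ranks polynomial in [2 ^ k]. *)
Lemma bad_count_negligible (rho : R) (kappa J : nat) : 0 < rho -> rho < 1 ->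
  exists l0 : nat, forall k l c : nat, (l0 <= l)%N -> (k <= kappa * l.+1)%N ->
    (c <= 2 ^ (k * J))%N -> c%:R * (3 * rho ^+ (2 ^ l)%N) <= 4^-1.
Proof.
move=> r0 r1; pose C : R := 3 * (2 ^ (kappa * J))%:R.
have [||n0 n0P] := @geometric_beats_power rho C 4^-1 (kappa * J) r0 r1.
- by rewrite mulr_ge0.
- by rewrite invr_gt0.
exists n0 => k l c l0 kl ck; apply: le_trans (n0P (2 ^ l)%N _); last first.
  by rewrite (leq_trans l0)// ltnW// ltn_expl.
rewrite mulrA ler_wpM2r ?exprn_ge0 ?(ltW r0)// mulrC /C -mulrA ler_wpM2l//.
rewrite -natrX -natrM ler_nat (leq_trans ck)// -expnM -expnD leq_exp2l//.
apply: (@leq_trans (kappa * l.+1 * J)); first by rewrite leq_mul2r kl orbT.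
by rewrite mulnS mulnDl [(l * _)%N]mulnCA mulnA.
Qed.

Lemma pow2_gt_threshold (M : R) : exists k0 : nat, forall k, (k0 <= k)%N ->
  M < (2 ^ k)%:R - (2 ^ k.-1)%:R.
Proof.
exists (Num.truncn M).+2 => -[//|k] kM.
rewrite expnS mul2n -addnn natrD addrK.
apply: lt_trans (truncnS_gt _) _; rewrite ltr_nat (leq_ltn_trans _ (ltn_expl k _))//.
Qed.

Lemma nat_above (x : R) : exists n : nat, x <= n%:R.
Proof. by exists (Num.truncn x).+1; rewrite ltW// truncnS_gt. Qed.

End Analysis.

Section Moment.
Context {disp : measure_display} {T : measurableType disp} {R : realType}
  (P : probability T R) (X : T -> R).
Hypothesis mX : measurable_fun setT X.

Lemma measurable_super_level a : measurable [set x | a < X x].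
Proof.
have := mX measurableT (measurable_itv `]a, +oo[%O).
rewrite setTI; congr measurable; apply/seteqP.
by split=> x /=; rewrite in_itv/= andbT.
Qed.

(** Dyadic layers: [X^p] is at most a constant plus the sum over [k >= k0] of
    [2^((k+1)p)] on the event [X > 2^k], and the expectations of these terms
    decay geometrically. *)
Lemma moment_finite (p p' : R) (k0 : nat) : 0 < p -> p < p' ->
  (forall k, (k0 <= k)%N ->
    (P [set x | ((2 ^ k)%:R < X x)%R] <= (2 `^ (- (k%:R * p')))%:E)%E) ->
  ('E_P[(fun x => X x `^ p)%R] < +oo)%E.
Proof.
move=> p0 pp' tail; rewrite unlock.
pose lvl n := [set x | ((2 ^ (n + k0))%:R : R) < X x].
have mlvl n : measurable (lvl n) by exact: measurable_super_level.
pose c n : R := 2 `^ ((n + k0).+1%:R * p).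
have c0 n : 0 <= c n by exact: powR_ge0.
pose f n x := ((c n)%:E * (\1_(lvl n) x)%:E)%E.
have f0 n x : (0 <= f n x)%E by rewrite mule_ge0// lee_fin.
have mf n : measurable_fun setT (f n).
  apply: measurable_funeM; apply/measurable_EFinP; exact: measurable_indic.
pose C : R := 1 + 2 `^ (k0%:R * p).
have C0 : 0 <= C by rewrite addr_ge0// powR_ge0.
have XC x : ((X x `^ p)%:E <= C%:E + \sum_(n <oo) f n x)%E.
  have S0 : (0 <= \sum_(n <oo) f n x)%E by apply: nneseries_ge0 => n _ _; exact: f0.
  (* At negative arguments [powR] is 1, hence the summand 1 in [C]. *)
  have [x0|x0] := leP (X x) 0.
    apply: (@le_trans _ _ C%:E); last by rewrite leeDl.
    rewrite lee_fin; apply: (@le_trans _ _ 1); last by rewrite lerDl powR_ge0.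
    move: x0; rewrite le_eqVlt => /predU1P[->|x0].
      by rewrite powR0 ?gt_eqF.
    by rewrite lt0_powR1.
  have [xk|xk] := leP (X x) (2 ^ k0)%:R.
    apply: (@le_trans _ _ C%:E); last by rewrite leeDl.
    rewrite lee_fin /C -[leLHS]add0r lerD// powRrM -pow2_powR.
    by apply: ge0_ler_powR; rewrite ?nnegrE ?(ltW p0) ?(ltW x0).
  have ex : exists n, X x <= (2 ^ n)%:R.
    exists (Num.truncn (X x)).+1; apply: ltW.
    apply: lt_le_trans (truncnS_gt _) _; rewrite ler_nat; exact/ltnW/ltn_expl.
  case: (ex_minnP ex) => n Xn nmin.
  have k0n : (k0 < n)%N.
    by rewrite ltnNge; apply/negP => nk; move: xk; rewrite ltNge (le_trans Xn)// ler_nat leq_exp2l.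
  have lv : lvl (n.-1 - k0)%N x.
    rewrite /lvl /= subnK; last by lia.
    rewrite ltNge; apply/negP => /nmin; lia.
  apply: (@le_trans _ _ (f (n.-1 - k0)%N x)).
    rewrite /f indicE mem_set// mule1 lee_fin /c.
    have -> : ((n.-1 - k0 + k0).+1 = n)%N by lia.
    by rewrite powRrM -pow2_powR; apply: ge0_ler_powR; rewrite ?nnegrE ?(ltW p0) ?(ltW x0).
  apply: (@le_trans _ _ (\sum_(i <oo) f i x)%E); last by rewrite leeDr// lee_fin.
  apply: le_trans (nneseries_lim_ge (n.-1 - k0).+1 _) => //.
  by rewrite big_nat_recr//= leeDr// sume_ge0.
apply: (@le_lt_trans _ _ (\int[P]_x (C%:E + \sum_(n <oo) f n x))%E).
  apply: ge0_le_integral => //.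
  - by move=> x _; rewrite lee_fin powR_ge0.
  - apply/measurable_EFinP.
    by apply: (measurableT_comp (measurable_powR _)).
  - by apply: emeasurable_funD => //; apply: ge0_emeasurable_sum.
rewrite ge0_integralD//; last 2 first.
- by move=> x _; apply: nneseries_ge0 => n _ _; exact: f0.
- by apply: ge0_emeasurable_sum.
have -> : (\int[P]_x C%:E)%E = C%:E.
  by rewrite integral_cst//= [X in (_ * X)%E](@probability_setT _ _ _ P) mule1.
rewrite integral_nneseries//.
pose q : R := 2 `^ (p - p').
pose A : R := 2 `^ p * 2 `^ (k0%:R * (p - p')).
have q0 : 0 < q by exact: powR_gt0.
have q1 : `|q| < 1.
  rewrite gtr0_norm// -(powRr0 2) /q /powR pnatr_eq0/= ltr_expR mul0r.
  by rewrite nmulr_rlt0 ?subr_lt0// ln_gt0// ltr1n.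
have A0 : 0 <= A by rewrite mulr_ge0// powR_ge0.
have fn n : (\int[P]_x f n x <= (geometric A q n)%:E)%E.
  rewrite ge0_integralZl_EFin//; last first.
    by apply/measurable_EFinP; exact: measurable_indic.
  rewrite integral_indic// setIT.
  apply: (@le_trans _ _ ((c n)%:E * (2 `^ (- ((n + k0)%:R * p')))%:E)%E).
    by rewrite lee_wpmul2l ?lee_fin//; apply: tail; exact: leq_addl.
  rewrite -EFinM lee_fin /c /geometric /= /A /q -powR_mulrn ?powR_ge0// -powRrM.
  rewrite -!powRD ?pnatr_eq0 ?implybT//.
  suff -> : (n + k0).+1%:R * p - (n + k0)%:R * p' =
    p + k0%:R * (p - p') + (p - p') * n%:R by [].
  by rewrite -addn1 !natrD; ring.
apply: (@le_lt_trans _ _ (C + A * (1 - q)^-1)%:E); last exact: ltry.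
rewrite [leRHS]EFinD leeD2l//.
apply: lime_le.
  by apply: is_cvg_nneseries => n _ _; apply: integral_ge0.
apply: nearW => n.
apply: (@le_trans _ _ (\sum_(0 <= i < n) (geometric A q i)%:E)%E).
  by apply: lee_sum => i _; exact: fn.
by rewrite sumEFin lee_fin; exact: geometric_le_lim.
Qed.

(** An infinite moment says nothing about any given level, but it forces heavy
    tails along a sequence of dyadic levels. *)
Lemma heavy_tail (p p' : R) : 0 < p -> p < p' ->
  ~ ('E_P[(fun x => X x `^ p)%R] < +oo)%E ->
  forall k0 : nat, exists2 k, (k0 <= k)%N &
    ((2 `^ (- (k%:R * p')))%:E < P [set x | ((2 ^ k)%:R < X x)%R])%E.
Proof.
move=> p0 pp' Einf k0; apply: contra_notP Einf => nk.
apply: (moment_finite p0 pp' (k0 := k0)) => k kk0.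
by rewrite leNgt; apply/negP => lt; apply: nk; exists k.
Qed.

End Moment.

(** * Instability for heavy radii *)

Section Criterion.
Context {R : realType} {d : nat} (Pt : probability (R * R)%type R).

Lemma unstableP : (forall (lambda : R), 0 < lambda ->
  forall (disp : measure_display) (Omega : measurableType disp)
    (P : probability Omega R)
    (gap : job d -> {RV P >-> R}) (mark : job d -> {RV P >-> (R * R)%type}),
    hail_jobs Pt lambda gap mark ->
  forall M : R, exists t F, [/\ 0 <= t, measurable F, (P F <= (2^-1)%:E)%E
    & forall w, ~ F w ->
       (M%:E < workload (hail_configuration gap mark w) t (0 : site d)%R)%E]) ->
  unstable d Pt.
Proof.
move=> crit [l1 l10 /(_ (l1 / 2))]; rewrite divr_gt0// => /(_ isT).
rewrite ltr_pdivrMr// ltr_pMr// ltr1n => /(_ isT).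
move=> [disp [T [P [gap [mark [hj tg]]]]]].
by apply: not_tight tg => M; apply: (crit (l1 / 2)) hj M; rewrite divr_gt0.
Qed.

Hypothesis hl : hail_law Pt.

(** A collecting job must contain its own center, that is, have a nonnegative
    radius; by [hail_law] this costs no probability. *)
Lemma tau_radius_ge0 (a : R) :
  measurable [set z : R * R | a < z.1 /\ 0 <= z.2] /\
  (Pt [set z | (a < z.1)%R] <= Pt [set z | (a < z.1)%R /\ (0 <= z.2)%R])%E.
Proof.
have mt : measurable [set z : R * R | a < z.1] by exact: measurable_tau_gt.
have mt0 : measurable [set z : R * R | 0 <= z.1].
  have := @measurable_tau R [set` `[0, +oo[] (measurable_itv _).
  by under eq_set do rewrite /= in_itv/= andbT.
have mr : measurable [set z : R * R | 0 <= z.2].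
  have := @measurable_radius R [set` `[0, +oo[] (measurable_itv _).
  by under eq_set do rewrite /= in_itv/= andbT.
have mG : measurable [set z : R * R | 0 <= z.1 /\ 0 <= z.2] by exact: measurableI.
have mB : measurable [set z : R * R | a < z.1 /\ 0 <= z.2] by exact: measurableI.
split=> //; have [PG _] := hl.
set B := [set z : R * R | a < z.1 /\ 0 <= z.2] in mB *.
set G := [set z : R * R | 0 <= z.1 /\ 0 <= z.2] in mG PG *.
have PGc : Pt (~` G) = 0%E by rewrite probability_setC// PG subee.
apply: (@le_trans _ _ (Pt (B `|` ~` G))).
  apply: le_measure; rewrite ?inE//.
    by apply: measurableU => //; exact: measurableC.
  move=> z /= az; have [Gz|nG] := pselect (G z); [left|by right].
  by split=> //; case: Gz.
apply: (@le_trans _ _ (Pt B + Pt (~` G))%E); last by rewrite PGc adde0.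
by apply: measureU2 => //; exact: measurableC.
Qed.

Lemma tau_charged : exists eta b : R, [/\ 0 < eta, 0 < b &
  (b%:E <= Pt [set z | (eta < z.1)%R])%E].
Proof.
have [_ P0] := hl.
have [n Pn] : exists n : nat, (0 < Pt [set z | (n.+1%:R^-1 < z.1)%R])%E.
  apply: contrapT => nex; move: P0; apply/negP; rewrite -leNgt.
  have -> : [set z : R * R | 0 < z.1] = \bigcup_n [set z | n.+1%:R^-1 < z.1].
    apply/seteqP; split=> z /=; last first.
      by move=> [n _ /=]; apply: lt_trans; rewrite invr_gt0.
    move=> z0; exists (Num.truncn z.1^-1) => //=.
    by rewrite invf_plt ?posrE// truncnS_gt.
  have mT (n : nat) : measurable [set z : R * R | n.+1%:R^-1 < z.1] by exact: measurable_tau_gt.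
  apply: (le_trans (generalized_Boole_inequality Pt mT (bigcupT_measurable _ mT))).
  rewrite eseries0// => n _ _; apply/eqP; rewrite eq_le measure_ge0 andbT leNgt.
  by apply/negP => Pn; apply: nex; exists n.
have mn := @measurable_tau_gt R n.+1%:R^-1.
exists n.+1%:R^-1, (fine (Pt [set z | n.+1%:R^-1 < z.1])); split.
- by rewrite invr_gt0.
- by rewrite fine_gt0// Pn/= (le_lt_trans (probability_le1 _ _))// ltry.
- by rewrite fineK// ge0_fin_numE// (le_lt_trans (probability_le1 _ _)) ?ltry.
Qed.

End Criterion.

Lemma size_job_box_pow2 (R : realType) d e n0 f :
  (size (job_box (d := d) (2 ^ e) n0 (2 ^ f)))%:R = 2 `^ (e%:R * d%:R + f%:R) :> R.
Proof. by rewrite size_job_box -expnM -expnD pow2_powR natrD natrM. Qed.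

Section HeavyRadius.
Context {R : realType} {d : nat} (Pt : probability (R * R)%type R).
Hypotheses (hl : hail_law Pt) (d_ge1 : (1 <= d)%N).

(** The unit of time is cut into [2K] slots.  In the even ones there is a job to
    collect, in the odd ones a job that covers all the sites and carries the
    path to the next place of interest. *)
Lemma workload_relay (c : configuration R d) (m K : nat) (eta M : R) :
  (0 < m)%N -> (0 < K)%N -> M + 1 < K%:R * eta ->
  (forall i, (i < K)%N -> exists2 x, x \in sites d m &
     [/\ (i.*2)%:R / (K.*2)%:R < arrival c (x, 0%N),
         arrival c (x, 0%N) <= (i.*2.+1)%:R / (K.*2)%:R,
         eta <= tsize c (x, 0%N) & 0 <= radius c (x, 0%N)]) ->
  (forall i, (i < K)%N -> exists2 x, x \in sites d m &
     [/\ (i.*2.+1)%:R / (K.*2)%:R < arrival c (x, 0%N),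
         arrival c (x, 0%N) <= (i.*2.+2)%:R / (K.*2)%:R
       & m%:R <= radius c (x, 0%N)]) ->
  (M%:E < workload c 1 (0 : site d)%R)%E.
Proof.
move=> m0 K0 MK collect jump.
have main n : (n <= K)%N -> forall y, y \in sites d m ->
    exists s, [/\ 0 <= s, s <= (n.*2)%:R / (K.*2)%:R & reach c s y (n%:R * eta)].
  elim: n => [|n IHn] nK y ym.
    by exists 0; rewrite mul0r lexx; split=> //; rewrite mul0r; exact: reach0.
  have [x xm [x1 x2 xe xr]] := collect n nK.
  have [z zm [z1 z2 zr]] := jump n nK.
  have [s [s0 sn rs]] := IHn (ltnW nK) x xm.
  have sx : s < arrival c (x, 0%N) by exact: le_lt_trans x1.
  have rx := reach_collect s0 sx (box_center _ xr) rs.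
  have xz : arrival c (x, 0%N) < arrival c (z, 0%N) by exact: le_lt_trans x2 z1.
  have x0 : 0 <= arrival c (x, 0%N) by rewrite (le_trans s0)// ltW.
  have rz := reach_jump x0 xz (sites_box zm xm zr) (sites_box zm ym zr) rx.
  exists (arrival c (z, 0%N)); split=> //; first by rewrite (le_trans x0)// ltW.
  by apply: reach_le rz; rewrite mulrSr mulrDl mul1r lerD2l.
have z0 : (0 : site d) \in sites d m.
  by rewrite -orthant_site0; exact: mem_sites.
have [s [s0]] := main K (leqnn K) _ z0.
rewrite divff ?pnatr_eq0 ?double_eq0 -?lt0n// => s1 rs.
apply: lt_le_trans (workload_ge ler01 (reach_wait s0 s1 rs)).
by rewrite lte_fin ltrBrDr.
Qed.

(** Already the first job of each site suffices: it falls into a given slot with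
    probability at least [a], so among [2^(k d)] sites both kinds of jobs are
    found in all slots. *)
Lemma unstable_heavy_radius (p' : R) : p' < d%:R ->
  (forall k0 : nat, exists2 k, (k0 <= k)%N &
    ((2 `^ (- (k%:R * p')))%:E < Pt [set z | ((2 ^ k)%:R < z.2)%R])%E) ->
  unstable d Pt.
Proof.
move=> p'd tail; apply: unstableP => lambda l0 disp Omega P gap mark hj M.
have [eta [b [eta0 b0 Pb]]] := tau_charged hl.
have [mB1 PB1] := tau_radius_ge0 hl eta.
set B1 := [set z | eta < z.1 /\ 0 <= z.2] in mB1 PB1 *.
have [K K0 KM] : exists2 K : nat, (0 < K)%N & M + 1 < K%:R * eta.
  by exists (Num.truncn ((M + 1) / eta)).+1; rewrite -?ltr_pdivrMr ?truncnS_gt.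
pose D : R := (K.*2)%:R.
have D0 : 0 < D by rewrite ltr0n double_gt0.
pose slot i : set R := [set` `](i%:R / D), (i.+1%:R / D)]].
have mslot i : measurable (slot i) by exact: measurable_itv.
pose a : R := expR (- lambda) * (1 - expR (- lambda * D^-1)).
have a0 : 0 < a.
  rewrite mulr_gt0 ?expR_gt0// subr_gt0 -expR0 ltr_expR mulNr oppr_lt0.
  by rewrite mulr_gt0// invr_gt0.
have ab0 : 0 < a * b by exact: mulr_gt0.
have slotP i : (i < K.*2)%N -> (a%:E <= exponential_prob lambda (slot i))%E.
  move=> iK; rewrite exponential_prob_oc// ?divr_ge0 ?(ltW D0)//; last first.
    by rewrite ler_pM2r ?invr_gt0// ler_nat.
  rewrite lee_fin -[in i.+1%:R]addn1 natrD mulrDl mul1r mulrDr expRD.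
  rewrite -[X in _ <= X - _]mulr1 -mulrBr ler_wpM2r//.
    by rewrite subr_ge0 -expR0 ler_expR mulNr oppr_le0 mulr_ge0 ?invr_ge0 ?ltW.
  rewrite ler_expR !mulNr lerN2 ler_piMr ?(ltW l0)//.
  by rewrite ler_pdivrMr// mul1r ler_nat ltnW.
have [k1 k1P] := pow2_unbounded ((K.*2.*2)%:R / (a * b)) (ltr01 : 0 < 1 :> R).
have dp : 0 < d%:R - p' by rewrite subr_gt0.
have [k2 k2P] := pow2_unbounded ((K.*2.*2)%:R / a) dp.
have [k] := tail (maxn k1 k2); rewrite geq_max => /andP[kk1 kk2] ktail.
set B2 := [set z | ((2 ^ k)%:R < z.2)%R] in ktail.
have mB2 : measurable B2 by exact: measurable_radius_gt.
pose m := (2 ^ k)%N.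
have m0 : (0 < m)%N by rewrite expn_gt0.
pose B i := if odd i then B2 else B1.
have mB i : measurable (B i) by rewrite /B; case: odd.
pose E i := job_event gap mark (slot i) (B i).
pose s : seq (job d) := job_box m 0 1.
have us : uniq s by exact: uniq_job_box.
pose F i := \bigcap_(j in [set` s]) ~` E i j.
have sizes : (size s)%:R = 2 `^ (k%:R * d%:R) :> R.
  by rewrite size_job_box muln1 -expnM pow2_powR natrM.
have small : expR (- (K.*2.*2)%:R) <= (K.*2.*2)%:R^-1 :> R.
  rewrite expRN lef_pV2 ?posrE ?expR_gt0 ?ltr0n ?double_gt0//.
  by apply: le_trans (expR_ge1Dx _); rewrite lerDr.
have FP i : i \in iota 0 K.*2 -> measurable (F i) /\
    (P (F i) <= ((K.*2.*2)%:R^-1)%:E)%E.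
  rewrite mem_iota => /andP[_ iK].
  have {}iK := slotP i iK.
  have [oi|ei] := boolP (odd i).
    have [||mFi PFi] := @no_job_le _ _ _ _ _ _ _ gap mark l0 hj (slot i) (B i) a
      (2 `^ (- (k%:R * p'))) (K.*2.*2)%:R s (mslot i) (mB i) (ltW a0)
      (powR_ge0 _ _) iK _ us _.
    - by rewrite /B oi ltW.
    - rewrite sizes -mulrA -powRD ?pnatr_eq0 ?implybT//.
      rewrite mulrC -ler_pdivrMr// (le_trans (k2P k kk2))//.
      by rewrite ler_powR ?ler1n// mulrBr addrC.
    by split=> //; apply: (le_trans PFi); rewrite lee_fin.
  have [||mFi PFi] := @no_job_le _ _ _ _ _ _ _ gap mark l0 hj (slot i) (B i) a
    b (K.*2.*2)%:R s (mslot i) (mB i) (ltW a0) (ltW b0) iK _ us _.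
  - by rewrite /B (negbTE ei) (le_trans Pb).
  - rewrite sizes mulrC -(ler_pdivrMr _ _ ab0) (le_trans (k1P k kk1))//.
    by rewrite ler_powR ?ler1n// ler_wpM2l// ler1n.
  by split=> //; apply: (le_trans PFi); rewrite lee_fin.
have mF i : measurable (F i).
  apply: fin_bigcap_measurable; first exact: finite_seq.
  by move=> j _; apply: measurableC; exact: measurable_job_event.
have [mU PU] := @union_bound _ _ _ P _ (iota 0 K.*2) F _ mF (fun i im => (FP i im).2).
exists 1, (\bigcup_(i in [set` iota 0 K.*2]) F i); split=> //.
  apply: (le_trans PU); rewrite lee_fin size_iota -(mul2n K.*2) natrM invfM.
  by rewrite mulrCA divff ?mulr1 ?gt_eqF.
move=> w nFw.
have get i : (i < K.*2)%N -> exists2 x, x \in sites d m &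
    slot i (gap (x, 0%N) w) /\ B i (mark (x, 0%N) w).
  move=> iK; have : ~ F i w.
    by move=> Fi; apply: nFw; exists i => //=; rewrite mem_iota.
  move=> /not_none[[x n]]; rewrite mem_job_box /= => /andP[xm].
  by rewrite ltnS leqn0 => /eqP -> [gx bx]; exists x.
apply: (@workload_relay _ m K eta M) => // i iK.
- have [|x xm []] := get i.*2; first by rewrite ltn_double.
  rewrite /slot /B odd_double /= in_itv/= => /andP[g1 g2] [/ltW t1 t2].
  by exists x => //; rewrite /= big_ord1.
- have [|x xm []] := get i.*2.+1; first by rewrite ltn_Sdouble.
  rewrite /slot /B /= odd_double /= in_itv/= => /andP[g1 g2] /ltW r1.
  by exists x => //; rewrite /= big_ord1.
Qed.

End HeavyRadius.

(** * Instability for heavy temporal sizes *)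

Section HeavyService.
Context {R : realType} {d : nat} (Pt : probability (R * R)%type R).
Hypotheses (hl : hail_law Pt) (nt : nontrivial Pt).

(** At time [2^(k-1)] with [L = 2^l]: half of the time is spent on the first
    [N0 = 2^(k-2-l)] jobs of each site, the other half on walking at most
    [m = 2^(k-2-2l)] steps of duration [L * L].  The jobs available for
    collection number [m^d N0], and their order [2^(k(d+1))] up to powers of [L]
    beats [2^(k(1+b'))]. *)
Lemma unstable_heavy_service (b' : R) : b' < d%:R ->
  (forall k0 : nat, exists2 k, (k0 <= k)%N &
    ((2 `^ (- (k%:R * (1 + b'))))%:E < Pt [set z | ((2 ^ k)%:R < z.1)%R])%E) ->
  unstable d Pt.
Proof.
move=> b'd tail; apply: unstableP => lambda l0 disp Omega P gap mark hj M.
have [rho [r0 r1 regP]] := regular_whp l0 hj nt.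
have del : 0 < d%:R - b' by rewrite subr_gt0.
(* The ratio [k / l] must be so large that the powers of [L] lost in the counting
   stay below half of the gain [2^(k(d-b'))]. *)
have [kappa [kap4 kapP]] : exists kappa : nat,
    (4 <= kappa)%N /\ 2 * (2 * d%:R + 1) <= kappa%:R * (d%:R - b').
  have [n nP] := nat_above (2 * (2 * d%:R + 1) / (d%:R - b')).
  exists (n + 4)%N; split; first exact: leq_addl.
  rewrite -ler_pdivrMr// (le_trans nP)// ler_nat; exact: leq_addr.
have [lmin lminP] := bad_count_negligible kappa (d + 2) r0 r1.
have [kM kMP] := pow2_gt_threshold M.
have [kd kdP] := nat_above (2 * (2 * d%:R + 5) / (d%:R - b')).
have [k] := tail (maxn (kappa * lmin) (maxn kM (maxn kd 4))).
rewrite !geq_max => /and4P[k_l k_M k_d k4] ktail.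
pose l := (k %/ kappa)%N.
have kap0 : (0 < kappa)%N by exact: leq_trans kap4.
have l_min : (lmin <= l)%N by rewrite /l leq_divRL// mulnC.
have k_up : (k <= kappa * l.+1)%N by rewrite mulnC ltnW// ltn_ceil.
have l_k : (kappa * l <= k)%N by rewrite mulnC leq_trunc_div.
have lk2 : (l.*2 + 2 <= k)%N.
  have : (4 * l <= k)%N by rewrite (leq_trans _ l_k)// leq_mul2r kap4 orbT.
  by clear - k4; lia.
clearbody l.
pose L := (2 ^ l)%N; pose m := (2 ^ (k - 2 - l.*2))%N.
pose N0 := (2 ^ (k - 2 - l))%N; pose q := (2 ^ k.-1).+1; pose N := (q * L + L)%N.
have L0 : (0 < L)%N by rewrite expn_gt0.
have [F1 [mF1 PF1 regF1]] := regP m L N.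
have {}PF1 : (P F1 <= (4^-1)%:E)%E.
  apply: (le_trans PF1); rewrite lee_fin.
  apply: (lminP k l) => //.
  have mk : (m ^ d <= 2 ^ (k * d))%N.
    by rewrite -expnM leq_exp2l// leq_mul2r; apply/orP; right; clear; lia.
  have Nk : (N <= 2 ^ (k * 2))%N.
    have -> : N = (L * (2 ^ k.-1 + 2))%N by rewrite /N /q; clear; lia.
    rewrite muln2 -addnn expnD leq_mul//; first by rewrite leq_exp2l//; clear - lk2; lia.
    have -> : (2 ^ k = 2 ^ k.-1 + 2 ^ k.-1)%N.
      by rewrite addnn -mul2n -expnS prednK//; clear - k4; lia.
    by rewrite leq_add2l -[X in (X <= _)%N](expn1 2) leq_exp2l//; clear - k4; lia.
  by rewrite mulnDr expnD leq_mul.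
have [mB PB] := tau_radius_ge0 hl (2 ^ k)%:R.
set B := [set z | (2 ^ k)%:R < z.1 /\ 0 <= z.2] in mB PB.
pose s : seq (job d) := job_box m 0 N0.
have us : uniq s by exact: uniq_job_box.
pose y : R := 2 `^ (- (k%:R * (1 + b'))) * (size s)%:R.
have [mF2 PF2] : measurable (\bigcap_(j in [set` s]) ~` job_event gap mark setT B j) /\
   (P (\bigcap_(j in [set` s]) ~` job_event gap mark setT B j) <= (expR (- y))%:E)%E.
  apply: (no_job_le l0 hj (a := 1) (b := 2 `^ (- (k%:R * (1 + b'))))) => //.
  - by rewrite exponential_probT.
  - by rewrite (le_trans (ltW ktail)).
  - by rewrite mul1r.
set F2 := \bigcap_(j in [set` s]) _ in mF2 PF2.
have {}PF2 : (P F2 <= (8^-1)%:E)%E.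
  apply: (le_trans PF2); rewrite lee_fin.
  pose X : R := - (k%:R * (1 + b')) + ((k - 2 - l.*2)%:R * d%:R + (k - 2 - l)%:R).
  apply: (@expRN_small _ X); last first.
    by rewrite /y size_job_box_pow2 -powRD ?pnatr_eq0 ?implybT.
  have e1 : (k - 2 - l.*2)%:R = k%:R - 2 - 2 * l%:R :> R.
    rewrite -subnDA natrB; last by clear - lk2; lia.
    by rewrite natrD -muln2 natrM; ring.
  have e2 : (k - 2 - l)%:R = k%:R - 2 - l%:R :> R.
    rewrite -subnDA natrB; last by clear - lk2; lia.
    by rewrite natrD; ring.
  rewrite /X e1 e2.
  have kd' : 2 * (2 * d%:R + 5) <= k%:R * (d%:R - b').
    by rewrite -ler_pdivrMr// (le_trans kdP)// ler_nat.
  have lk' : kappa%:R * l%:R <= k%:R :> R by rewrite -natrM ler_nat.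
  have h1 : l%:R * (2 * (2 * d%:R + 1)) <= l%:R * (kappa%:R * (d%:R - b')).
    by rewrite ler_wpM2l.
  have h2 : kappa%:R * l%:R * (d%:R - b') <= k%:R * (d%:R - b').
    by rewrite ler_wpM2r// ltW.
  move: kd' h1 h2; set kR := k%:R; set lR := l%:R; set dR := d%:R; set kp := kappa%:R.
  by clear; nra.
exists (2 ^ k.-1)%:R, (F1 `|` F2); split=> //.
- exact: measurableU.
- apply: (le_trans (prob_setU_le mF1 mF2 PF1 PF2)); rewrite lee_fin; lra.
move=> w /not_orP[nF1 nF2].
have reg := regF1 w nF1.
have [[x n]] := not_none nF2.
rewrite mem_job_box add0n /= => /andP[xm nN0] [_ [tbig rpos]].
have N0N : (N0 <= N)%N.
  apply: (@leq_trans q); last by rewrite /N (leq_trans _ (leq_addr _ _))// leq_pmulr.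
  by rewrite ltnW// ltnS leq_exp2l//; clear; lia.
apply: (@lt_le_trans _ _ ((mark (x, n) w).1 - (2 ^ k.-1)%:R)%:E).
  by rewrite lte_fin (lt_trans (kMP k k_M))// ltrD2r.
have tL : (N0 * L + m * (L * L))%:R <= (2 ^ k.-1)%:R :> R.
  rewrite ler_nat -!expnD.
  have -> : (k - 2 - l + l = k.-2)%N by clear - lk2; lia.
  have -> : (k - 2 - l.*2 + (l + l) = k.-2)%N by clear - lk2; lia.
  by rewrite addnn -mul2n -expnS; clear - k4; case: k k4 => [|[|k]].
apply: (@workload_crawl _ _ (hail_configuration gap mark w) (fun j => gap j w)
  m L N L0 _ reg (x, n) N0 xm nN0 N0N rpos q) => //.
by rewrite ltr_nat.
Qed.

End HeavyService.

(** * Unstable laws with finite moments *)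

Section Pareto.
Variable R : realType.

(** The factor 2 in the lower bound comes from keeping only the window
    [y < x <= y + 1] of the tail. *)
Lemma exponential_tail (E : probability (measurableTypeR R) R) :
  (forall A, E A = exponential_prob 1 A) -> forall (y : R) (A : set R), 0 <= y ->
  measurable A -> (forall x, A x <-> y < x) ->
  ((expR (- y) / 2)%:E <= E A)%E /\ (E A <= (expR (- y))%:E)%E.
Proof.
move=> EE y A y0 mA Ay; have l01 : 0 < 1 :> R by exact: ltr01.
split.
  apply: (@le_trans _ _ (E [set` `]y, y + 1]])).
    rewrite EE exponential_prob_oc ?lerDl// lee_fin mulN1r mulN1r opprD expRD.
    have e1 : expR (- 1) <= 2^-1 :> R.
      rewrite expRN lef_pV2 ?posrE ?expR_gt0//.
      by apply: le_trans (expR_ge1Dx 1); rewrite -[leLHS]/(1 + 1).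
    by have := expR_gt0 (- y); nra.
  apply: le_measure; rewrite ?inE//.
  by move=> x /=; rewrite in_itv/= => /andP[yx _]; apply/Ay.
apply: (@le_trans _ _ (E (~` [set` `]0, y]]))).
  apply: le_measure; rewrite ?inE//; first by apply: measurableC; exact: measurable_itv.
  by move=> x /Ay yx /=; rewrite in_itv/= => /andP[_]; rewrite leNgt yx.
rewrite EE exponential_prob_oc_compl// lee_fin mulr0 expR0 mulN1r; lra.
Qed.

(** The image of an exponential variable [x] under [expR (x / p)] has the tail
    [s^-p]; both coordinates may use the same [x], since the instability argument
    looks for long and for wide jobs among different jobs. *)
Lemma pareto_law (p1 p2 : R) : 0 < p1 -> 0 < p2 ->
  exists Pt : probability (R * R)%type R, [/\ hail_law Pt, nontrivial Pt &
  forall k : nat,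
   [/\ ((2 `^ (- (k%:R * p1)) / 2)%:E <= Pt [set z | ((2 ^ k)%:R < z.1)%R])%E,
       (Pt [set z | ((2 ^ k)%:R < z.1)%R] <= (2 `^ (- (k%:R * p1)))%:E)%E,
       ((2 `^ (- (k%:R * p2)) / 2)%:E <= Pt [set z | ((2 ^ k)%:R < z.2)%R])%E
     & (Pt [set z | ((2 ^ k)%:R < z.2)%R] <= (2 `^ (- (k%:R * p2)))%:E)%E]].
Proof.
move=> p10 p20; have [E EE] := exponential_law (ltr01 : 0 < 1 :> R).
pose f (x : measurableTypeR R) : (R * R)%type := (expR (x / p1), expR (x / p2)).
have mexp p : measurable_fun setT (fun x : measurableTypeR R => expR (x / p)).
  by apply: measurableT_comp => //; exact: mulrr_measurable.
have mf : measurable_fun setT f by apply/measurable_fun_pair.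
pose X : {mfun measurableTypeR R >-> (R * R)%type} := mfun_Sub (mem_set mf).
pose Pt : probability (R * R)%type R := distribution E X.
have PtE A : Pt A = E (f @^-1` A) by [].
have lvl p : 0 < p -> forall (k : nat) x, ((2 ^ k)%:R < expR (x / p)) = (k%:R * p * ln 2 < x).
  move=> p0 k x; rewrite pow2_powR /powR pnatr_eq0/= ltr_expR ltr_pdivlMr//.
  by rewrite mulrAC.
have tail p : 0 < p -> forall k : nat,
   ((2 `^ (- (k%:R * p)) / 2)%:E <= E [set x | ((2 ^ k)%:R < expR (x / p))%R])%E /\
   (E [set x | ((2 ^ k)%:R < expR (x / p))%R] <= (2 `^ (- (k%:R * p)))%:E)%E.
  move=> p0 k; rewrite /powR pnatr_eq0/= mulNr.
  apply: (exponential_tail EE).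
  - by rewrite !mulr_ge0 ?(ltW p0)// ln_ge0// ler1n.
  - exact: (measurable_super_level (mexp p)).
  - by move=> x /=; rewrite lvl.
exists Pt; split.
- split; rewrite PtE.
    rewrite (_ : _ @^-1` _ = setT) ?probability_setT//.
    by apply/seteqP; split=> // x _ /=; rewrite !expR_ge0.
  rewrite (_ : _ @^-1` _ = setT) ?probability_setT ?lte01//.
  by apply/seteqP; split=> // x _ /=; rewrite expR_gt0.
- rewrite /nontrivial PtE.
  apply: (@le_lt_trans _ _ (E (~` [set` `]0, 1]]))).
    apply: le_measure; rewrite ?inE//; last first.
    + move=> x /=; rewrite -expR0 ltr_expR in_itv/= ltr_pdivrMr// mul0r => x0.
      by move=> /andP[/ltW]; rewrite leNgt x0.
    + by apply: measurableC; exact: measurable_itv.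
    + rewrite -[X in measurable X]setTI; apply: (mf) => //.
      have := @measurable_radius R [set` `]-oo, 1[] (measurable_itv _).
      by under eq_set do rewrite /= in_itv/=.
  rewrite EE exponential_prob_oc_compl// lte_fin mulr0 expR0 mulN1r.
  by rewrite subKr -expR0 ltr_expR oppr_lt0.
- by move=> k; have [? ?] := tail _ p10 k; have [? ?] := tail _ p20 k.
Qed.

End Pareto.

Section Leap.
Context {R : realType} {d : nat} (Pt : probability (R * R)%type R).
Hypotheses (hl : hail_law Pt) (nt : nontrivial Pt).

(** At time [2^(k-1)] with [L = 2^l] and cubes of side [2^e], [e] close to [c k].
    The job to collect has rank below [N0] and so arrives before
    [N0 L = 2^(k-2-3l)]; the leaping job has rank between [n1 = 2^(k-2-l)] and
    [2 n1], hence arrives after that time and before the end.  The hypotheses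
    on [c] make the numbers of both kinds of jobs grow with [k]. *)
Lemma unstable_leap (a' b' c : R) : 0 <= a' -> 0 < c -> b' < c * d%:R -> c * a' < 1 ->
  (forall k : nat,
    ((2 `^ (- (k%:R * (1 + b')) - 1))%:E <= Pt [set z | ((2 ^ k)%:R < z.1)%R])%E) ->
  (forall k : nat,
    ((2 `^ (- (k%:R * (d%:R + a')) - 1))%:E <= Pt [set z | ((2 ^ k)%:R < z.2)%R])%E) ->
  unstable d Pt.
Proof.
move=> a'0 c0 b'c ca' tail1 tail2; apply: unstableP => lambda l0 disp Omega P gap mark hj M.
have [rho [r0 r1 regP]] := regular_whp l0 hj nt.
have del1 : 0 < c * d%:R - b' by rewrite subr_gt0.
have del2 : 0 < 1 - c * a' by rewrite subr_gt0.
have [kappa [kap8 kapP1 kapP2]] : exists kappa : nat,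
    [/\ (8 <= kappa)%N, 8 <= kappa%:R * (c * d%:R - b') &
        2 <= kappa%:R * (1 - c * a')].
  have [n nP] := nat_above (8 / (c * d%:R - b')).
  have [n' nP'] := nat_above (2 / (1 - c * a')).
  exists (n + n' + 8)%N; split; first exact: leq_addl.
    by rewrite -ler_pdivrMr// (le_trans nP)// ler_nat -addnA leq_addr.
  by rewrite -ler_pdivrMr// (le_trans nP')// ler_nat addnAC leq_addl.
have [ch chP] := nat_above c.
have [lmin lminP] := bad_count_negligible kappa (ch * d + 1) r0 r1.
have [kM kMP] := pow2_gt_threshold M.
have [k1 k1P] := nat_above (2 * (d%:R + 6) / (c * d%:R - b')).
have [k2 k2P] := nat_above (12 / (1 - c * a')).
have [k [k_l k_M k_1 k_2 k4]] : exists k,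
    [/\ (kappa * lmin.+1 <= k)%N, (kM <= k)%N, (k1 <= k)%N, (k2 <= k)%N & (4 <= k)%N].
  exists (kappa * lmin.+1 + kM + k1 + k2 + 4)%N.
  by clear; split; lia.
pose l := (k %/ kappa)%N.
have kap0 : (0 < kappa)%N by exact: leq_trans kap8.
have l_min : (lmin < l)%N by rewrite /l leq_divRL// mulnC.
have k_up : (k <= kappa * l.+1)%N by rewrite mulnC ltnW// ltn_ceil.
have l_k : (kappa * l <= k)%N by rewrite mulnC leq_trunc_div.
have lk4 : (4 * l + 2 <= k)%N.
  have : (8 * l <= k)%N by rewrite (leq_trans _ l_k)// leq_mul2r kap8 orbT.
  by clear - k4; lia.
clearbody l.
have l1 : (0 < l)%N by exact: leq_trans l_min.
pose e := Num.truncn (c * k%:R).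
have ck0 : 0 <= c * k%:R by rewrite mulr_ge0// ltW.
have e_le : e%:R <= c * k%:R by rewrite truncn_le.
have e_gt : c * k%:R < e%:R + 1 by rewrite natr1 truncnS_gt.
have e_ch : (e <= ch * k)%N.
  by rewrite -(ler_nat R) (le_trans e_le)// natrM ler_wpM2r.
clearbody e.
pose L := (2 ^ l)%N; pose m := (2 ^ e)%N; pose N0 := (2 ^ (k - 2 - 4 * l))%N.
pose n1 := (2 ^ (k - 2 - l))%N; pose q := (2 ^ (k - 2 - 3 * l)).+1.
pose N := (n1 + n1)%N.
have L0 : (0 < L)%N by rewrite expn_gt0.
have NE : N = (2 ^ (k - 1 - l))%N.
  by rewrite /N /n1 addnn -mul2n -expnS; congr (2 ^ _)%N; clear - lk4; lia.
have [F1 [mF1 PF1 regF1]] := regP m L N.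
have {}PF1 : (P F1 <= (4^-1)%:E)%E.
  apply: (le_trans PF1); rewrite lee_fin.
  apply: (lminP k l) => //; first exact: ltnW.
  rewrite NE -expnM -expnD leq_exp2l//.
  have : (e * d <= ch * k * d)%N by rewrite leq_mul2r e_ch orbT.
  by clear; nia.
have small (e' : nat) (p : R) (A : set (R * R)) n0 f (X : R) : measurable A ->
    ((2 `^ (- (e'%:R * p) - 1))%:E <= Pt A)%E ->
    3 <= X -> X = - (e'%:R * p) - 1 + (e%:R * d%:R + f%:R) ->
    exists F, [/\ measurable F, (P F <= (8^-1)%:E)%E & forall w, ~ F w ->
      exists2 j : job d, j \in job_box m n0 (2 ^ f) & A (mark j w)].
  move=> mA PA X3 XE.
  pose s : seq (job d) := job_box m n0 (2 ^ f).
  exists (\bigcap_(j in [set` s]) ~` job_event gap mark setT A j).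
  pose y : R := 2 `^ (- (e'%:R * p) - 1) * (size s)%:R.
  have [||||mF PF] := @no_job_le _ _ _ _ _ _ _ gap mark l0 hj setT A 1
    (2 `^ (- (e'%:R * p) - 1)) y s measurableT mA _ _ _ PA (uniq_job_box _ _ _) _.
  - exact: ler01.
  - exact: powR_ge0.
  - by rewrite exponential_probT.
  - by rewrite mul1r.
  - split=> //.
      apply: (le_trans PF); rewrite lee_fin; apply: (expRN_small X3).
      by rewrite /y size_job_box_pow2 -powRD ?pnatr_eq0 ?implybT// XE.
    by move=> w /not_none[j js [_ Aj]]; exists j.
have lk' : kappa%:R * l%:R <= k%:R :> R by rewrite -natrM ler_nat.
have [mB1 PB1] := tau_radius_ge0 hl (2 ^ k)%:R.
have mB2 : measurable [set z : R * R | (2 ^ e)%:R < z.2] by exact: measurable_radius_gt.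
have e1 : (k - 2 - 4 * l)%:R = k%:R - 2 - 4 * l%:R :> R.
  rewrite -subnDA natrB; last by clear - lk4; lia.
  by rewrite natrD natrM; ring.
have e2 : (k - 2 - l)%:R = k%:R - 2 - l%:R :> R.
  rewrite -subnDA natrB; last by clear - lk4; lia.
  by rewrite natrD; ring.
have big1 : 3 <= - (k%:R * (1 + b')) - 1 + (e%:R * d%:R + (k - 2 - 4 * l)%:R).
  rewrite e1.
  have kd' : 2 * (d%:R + 6) <= k%:R * (c * d%:R - b').
    by rewrite -ler_pdivrMr// (le_trans k1P)// ler_nat.
  have h1 : l%:R * 8 <= l%:R * (kappa%:R * (c * d%:R - b')) by rewrite ler_wpM2l.
  have h2 : kappa%:R * l%:R * (c * d%:R - b') <= k%:R * (c * d%:R - b').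
    by rewrite ler_wpM2r// ltW.
  have h3 : (c * k%:R - 1) * d%:R <= e%:R * d%:R.
    by rewrite ler_wpM2r// lerBlDr ltW.
  move: kd' h1 h2 h3; set kR := k%:R; set lR := l%:R; set dR := d%:R.
  by set kp := kappa%:R; set eR := e%:R; clear; nra.
have big2 : 3 <= - (e%:R * (d%:R + a')) - 1 + (e%:R * d%:R + (k - 2 - l)%:R).
  rewrite e2.
  have kd' : 12 <= k%:R * (1 - c * a').
    by rewrite -ler_pdivrMr// (le_trans k2P)// ler_nat.
  have h1 : l%:R * 2 <= l%:R * (kappa%:R * (1 - c * a')) by rewrite ler_wpM2l.
  have h2 : kappa%:R * l%:R * (1 - c * a') <= k%:R * (1 - c * a').
    by rewrite ler_wpM2r// ltW.
  have h3 : e%:R * a' <= c * k%:R * a' by rewrite ler_wpM2r.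
  move: kd' h1 h2 h3; set kR := k%:R; set lR := l%:R; set dR := d%:R.
  by set kp := kappa%:R; set eR := e%:R; clear; nra.
have [F2 [mF2 PF2 F2P]] := small k _ _ 0%N (k - 2 - 4 * l)%N _ mB1
  (le_trans (tail1 k) PB1) big1 erefl.
have [F3 [mF3 PF3 F3P]] := small e _ _ n1 (k - 2 - l)%N _ mB2 (tail2 e) big2 erefl.
have mF23 : measurable (F2 `|` F3) by exact: measurableU.
exists (2 ^ k.-1)%:R, (F1 `|` (F2 `|` F3)); split=> //.
- exact: measurableU.
- apply: (le_trans (prob_setU_le mF1 mF23 PF1 (prob_setU_le mF2 mF3 PF2 PF3))).
  by rewrite lee_fin; lra.
move=> w /not_orP[nF1 /not_orP[nF2 nF3]].
have reg := regF1 w nF1.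
have [[x n]] := F2P w nF2.
rewrite mem_job_box add0n /= => /andP[xm nN0] [tbig rpos].
have [[z i]] := F3P w nF3.
rewrite mem_job_box /= => /andP[zm /andP[n1i iN]] zbig.
apply: (@lt_le_trans _ _ ((mark (x, n) w).1 - (2 ^ k.-1)%:R)%:E).
  by rewrite lte_fin (lt_trans (kMP k k_M))// ltrD2r.
have N0N : (N0 <= N)%N by rewrite NE leq_exp2l//; clear; lia.
have N0q : (N0 * L < q)%N.
  by rewrite /q ltnS -expnD leq_exp2l//; clear - lk4; lia.
have qi : (q * L <= i.+1)%N.
  apply: (@leq_trans n1); last by rewrite leqW.
  have -> : (q * L = 2 ^ (k - 2 - 3 * l + l) + 2 ^ l)%N.
    by rewrite /q mulSn addnC expnD.
  apply: (@leq_trans (2 ^ (k - 2 - 2 * l).+1)%N); last first.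
    by rewrite leq_exp2l//; clear - lk4 l1; lia.
  by rewrite expnS mul2n -addnn leq_add// leq_exp2l//; clear - lk4; lia.
have Nt : (N * L)%:R <= (2 ^ k.-1)%:R :> R.
  by rewrite ler_nat NE -expnD leq_exp2l//; clear - lk4; lia.
apply: (@workload_leap _ _ (hail_configuration gap mark w) (fun j => gap j w)
  m L N L0 _ reg (x, n) N0 xm nN0 N0N rpos (z, i) N q) => //.
exact: ltW.
Qed.

End Leap.

(** * The three statements *)

Section Final.
Variable R : realType.

Lemma unstable_beta (d : nat) (Pt : probability (R * R)%type R) :
  hail_law Pt -> nontrivial Pt -> (1 <= d)%N ->
  (beta Pt < d%:R%:E)%E -> unstable d Pt.
Proof.
move=> hl nt d1 bd.
have [b [b0 bb bd']] : exists b : R, [/\ 0 < b, (beta Pt < b%:E)%E & b < d%:R].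
  have d0 : 0 < d%:R :> R by rewrite ltr0n.
  case: (beta Pt) bd => [r| |] //= rd.
    move: rd; rewrite lte_fin => rd.
    exists ((Num.max 0 r + d%:R) / 2).
    have := le_max 0 (0:R) r; have := le_max r (0:R) r; rewrite !lexx orbT /=.
    have : Num.max 0 r < d%:R by rewrite gt_max d0.
    by move: (Num.max 0 r) => u ? ru u0; split; rewrite ?lte_fin; lra.
  by exists (d%:R / 2); split; rewrite ?ltNyr//; lra.
apply: (@unstable_heavy_service _ _ _ hl nt ((b + d%:R) / 2)); first lra.
have mfst : measurable_fun setT (fst : R * R -> R) by exact: measurable_fst.
apply: (heavy_tail mfst (p := 1 + b)); [lra|lra|].
move=> fin; move: bb; apply/negP; rewrite -leNgt.
by apply: ereal_sup_ubound; exists b => //; split=> //; lra.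
Qed.

Lemma unstable_alpha (d : nat) (Pt : probability (R * R)%type R) :
  hail_law Pt -> (1 <= d)%N -> (alpha d Pt < 0)%E -> unstable d Pt.
Proof.
move=> hl d1 al.
have [a [a0 aa da]] : exists a : R, [/\ a < 0, (alpha d Pt < a%:E)%E & - d%:R < a].
  have d0 : 0 < d%:R :> R by rewrite ltr0n.
  case: (alpha d Pt) al => [r| |] //= rd.
    move: rd; rewrite lte_fin => rd.
    exists ((Num.max (- d%:R) r) / 2).
    have := le_max (- d%:R) (- d%:R : R) r; have := le_max r (- d%:R : R) r.
    rewrite !lexx orbT /=.
    have : Num.max (- d%:R) r < 0 by rewrite gt_max rd oppr_lt0 d0.
    by move: (Num.max (- d%:R) r) => u ? ru u0; split; rewrite ?lte_fin; lra.
  by exists (- d%:R / 2); split; rewrite ?ltNyr//; lra.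
apply: (@unstable_heavy_radius _ _ _ hl d1 (d%:R + a / 2)); first lra.
have msnd : measurable_fun setT (snd : R * R -> R) by exact: measurable_snd.
apply: (heavy_tail msnd (p := d%:R + a)); [lra|lra|].
move=> fin; move: aa; apply/negP; rewrite -leNgt.
by apply: ereal_sup_ubound; exists a => //; split=> //; lra.
Qed.

Lemma unstable_example (d : nat) (a b : R) : (1 <= d)%N ->
  a * b < d%:R -> d%:R < b -> 0 < a -> a < 1 ->
  exists Pt : probability (R * R)%type R,
    [/\ hail_law Pt,
        ('E_Pt[(fun z => z.2 `^ (d%:R + a) + z.1 `^ (1 + b))%R] < +oo)%E
      & unstable d Pt].
Proof.
move=> d1 abd db a0 a1.
have d0 : 0 < d%:R :> R by rewrite ltr0n.
have b0 : 0 < b by exact: lt_trans db.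
(* The exponent [c] of the side of the cube is fixed first, and leaves room for
   [a'] above [a] and [b'] above [b]. *)
pose c := (b / d%:R + a^-1) / 2.
have c0 : 0 < c by rewrite divr_gt0// addr_gt0 ?divr_gt0 ?invr_gt0.
have bc : b < c * d%:R.
  rewrite -ltr_pdivrMr// /c.
  have : b / d%:R < a^-1 by rewrite ltr_pdivrMr// mulrC ltr_pdivlMr// mulrC.
  by lra.
have ac : a < c^-1.
  rewrite -(invrK a) ltf_pV2 ?posrE ?invr_gt0// /c.
  have : b / d%:R < a^-1 by rewrite ltr_pdivrMr// mulrC ltr_pdivlMr// mulrC.
  by lra.
pose a' := (a + c^-1) / 2; pose b' := (b + c * d%:R) / 2.
have aa' : a < a' by rewrite /a'; lra.
have bb' : b < b' by rewrite /b'; lra.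
have b'c : b' < c * d%:R by rewrite /b'; lra.
have ca' : c * a' < 1 by rewrite mulrC -ltr_pdivlMr// div1r /a'; lra.
have [||Pt [hl nt tails]] := @pareto_law R (1 + b') (d%:R + a'); [lra|lra|].
exists Pt; split=> //; last first.
  apply: (@unstable_leap _ _ _ hl nt a' b' c) => //; first lra.
  - move=> k; have [+ _ _ _] := tails k.
    by rewrite powRB ?powRr1// pnatr_eq0 implybT.
  - move=> k; have [_ _ + _] := tails k.
    by rewrite powRB ?powRr1// pnatr_eq0 implybT.
have mfst : measurable_fun setT (fst : R * R -> R) by exact: measurable_fst.
have msnd : measurable_fun setT (snd : R * R -> R) by exact: measurable_snd.
have Etau : ('E_Pt[(fun z => z.1 `^ (1 + b))%R] < +oo)%E.
  apply: (moment_finite mfst (p' := 1 + b') (k0 := 0%N)); [lra|lra|].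
  by move=> k _; have [_ + _ _] := tails k.
have Er : ('E_Pt[(fun z => z.2 `^ (d%:R + a))%R] < +oo)%E.
  apply: (moment_finite msnd (p' := d%:R + a') (k0 := 0%N)); [lra|lra|].
  by move=> k _; have [_ _ _ +] := tails k.
move: Etau Er; rewrite unlock => Etau Er.
under eq_integral do rewrite EFinD.
rewrite ge0_integralD//.
- exact: lte_add_pinfty.
- by move=> z _; rewrite lee_fin powR_ge0.
- by apply/measurable_EFinP; apply: (measurableT_comp (measurable_powR _)).
- by move=> z _; rewrite lee_fin powR_ge0.
- by apply/measurable_EFinP; apply: (measurableT_comp (measurable_powR _)).
Qed.

End Final.

Theorem theorem1p1 (R : realType) (d : nat) (d_ge1 : (1 <= d)%N) :
  [/\ forall Pt : probability (R * R)%type R, hail_law Pt -> nontrivial Pt ->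
        (beta Pt < d%:R%:E)%E -> unstable d Pt,
      forall Pt : probability (R * R)%type R, hail_law Pt -> nontrivial Pt ->
        (alpha d Pt < 0)%E \/ (beta Pt <= 0)%E -> unstable d Pt
    & forall a b : R, a * b < d%:R -> d%:R < b -> 0 < a -> a < 1 ->
        exists Pt : probability (R * R)%type R,
          [/\ hail_law Pt,
              ('E_Pt[(fun z => z.2 `^ (d%:R + a) + z.1 `^ (1 + b))%R] < +oo)%E
            & unstable d Pt]].
Proof.
split=> [Pt hl nt bd|Pt hl nt [al|be]|a b].
- exact: unstable_beta.
- exact: unstable_alpha.
- apply: unstable_beta => //; apply: le_lt_trans be _.
  by rewrite lte_fin ltr0n.
- exact: unstable_example.
Qed.
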